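(* Let $\mathscr K$ be a Noetherian integral domain with fraction field $K$, $H$ a finite and torsion-free $\mathscr K$-algebra with $H_K$ semisimple, and let $\mathscr S=\bigcup_h\mathscr S_h$ and the exact category $(\mathscr A(\mathscr S),\mathscr E(\mathscr S))$ be as in the context. Suppose $(\mathscr A_\flat,\mathscr E_\flat)$ is a full exact subcategory of $(\mathscr A(\mathscr S),\mathscr E(\mathscr S))$, with $\mathscr A_\flat\hookrightarrow\mathscr A(\mathscr S)$ an inclusion of $\mathscr K$-categories, such that: (1) $\mathscr A_\flat$ is closed under isomorphisms of objects in $\mathscr A(\mathscr S)$; (2) all objects of $\mathscr S$ are contained in $\mathscr A_\flat$; (3) if $M\in\mathscr A_\flat$ and $h$ is an integer, then $M^h$, $M^{h-1}$ and $M^h/M^{h-1}$ belong to $\mathscr A_\flat$, and $(M^{h-1}\to M^h\to M^h/M^{h-1})$ belongs to $\mathscr E_\flat$; (4) for $M,N,P\in\mathscr A_\flat$, if $(M\to N\to P)\in\mathscr E_\flat$, then $(M^h\to N^h\to P^h)\in\mathscr E_\flat$ for all integers $h$. Assume moreover that for each integer $h$ there is a finite set $F(h)$ of objects such that every object of $\mathscr S_h$ is isomorphic to a finite direct sum of objects chosen from $F(h)$. Then, given $M\in\mathscr A_\flat$, there exist an object $X=X_M$ in $\mathscr A_\flat$ and an inflation $i:M\to X$ in $(\mathscr A_\flat,\mathscr E_\flat)$ such that $\mathrm{Ext}^1_{\mathscr E_\flat}(S,X)=0$ for all $S\in\mathscr S$. In addition, if $h$ is chosen minimal such that $M^{h-1}\ne0$,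 it may be assumed that the inflation $i$ induces an isomorphism $M^{h-1}\cong X^{h-1}$.
   Context: All modules are right modules; ''finite'' means finitely generated. $\Lambda$ is the (finite) set of isomorphism classes of irreducible $H_K$-modules, with a given height function $\mathfrak h:\Lambda\to\mathbb Z$ taking positive values. For an $H$-module $M$ which is finite and torsion-free over $\mathscr K$ and $h\in\mathbb Z$, $M^h=M\cap(M_K)^{\le h}$, where $(M_K)^{\le h}$ is the sum of all irreducible $H_K$-submodules of $M_K$ of height $\le h$. For each integer $i$, $\mathscr S_i$ is a full additive subcategory, closed under isomorphism, of the category of finite $\mathscr K$-torsion-free $H$-modules, such that for each $S\in\mathscr S_i$, $S_K$ is a direct sum of finitely many irreducible modules of height $i$ ($\mathscr S_i$ consists of zero objects if $i$ is not a value of $\mathfrak h$); $\mathscr S=\bigcup_i\mathscr S_i$. $\mathscr A(\mathscr S)$ is the full subcategory of mod-$H$ of finite torsion-free $M$ with $M^h/M^{h-1}\in\mathscr S_h$ for all $h$. $\mathscr E(\mathscr S)$ consists of the short exact sequences $0\to M\to N\to P\to0$ of mod-$H$ with terms in $\mathscr A(\mathscr S)$ such that $0\to M^h/M^{h-1}\to N^h/N^{h-1}\to P^h/P^{h-1}\to0$ is split exact for all $h$; $(\mathscr A(\mathscr S),\mathscr E(\mathscr S))$ is an exact category in Quillen's sense. A full exact subcategory of an exact category $(\mathscr B,\mathscr F)$ is an exact category $(\mathscr A_\flat,\mathscr E_\flat)$ with $\mathscr A_\flat$ a full subcategory of $\mathscr B$ and $\mathscr E_\flat\subseteq\mathscr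 F$. An inflation in $(\mathscr A_\flat,\mathscr E_\flat)$ is the first map of a sequence in $\mathscr E_\flat$. $\mathrm{Ext}^1_{\mathscr E_\flat}(Y,Z)$ is the $\mathscr K$-module of equivalence classes of sequences $(Z\to E\to Y)$ in $\mathscr E_\flat$. *)

(* Defs.v *)
From HB Require Import structures.
From mathcomp Require Import all_boot all_order all_algebra.
From mathcomp Require Import generic_quotient ring zify.
From mathcomp Require Import boolp classical_sets.

Set Implicit Arguments.
Unset Strict Implicit.
Unset Printing Implicit Defensive.

Import Order.TTheory GRing.Theory Num.Theory.
Local Open Scope ring_scope.
Local Open Scope quotient_scope.
Local Open Scope classical_set_scope.

(** A right module over a ring R is an [lmodType R^c], with [R^c] the converse
    ring; for x : R and v in such a module, v x is written [(x : R^c) *: v]. *)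

(** ** Submodules and quotient modules *)

Section Submodules.
Variables (R : pzRingType) (V : lmodType R).

Definition submodule (W : set V) : Prop :=
  W 0 /\ forall a u v, W u -> W v -> W (a *: u + v).

Record submod := Submod { submod_set :> V -> Prop; submodP : submodule submod_set }.

(* The sum of a family of submodules: the least submodule containing them all *)
Definition sum_submod (F : set (set V)) : set V :=
  smallest submodule (\bigcup_(W in F) W).

Lemma sum_submodP F : submodule (sum_submod F).
Proof.
split=> [W [[W0 _] _] //|a u v su sv W FW].
by case: (FW) => -[_ WD] _; apply: WD; [exact: su|exact: sv].
Qed.

Section OneSubmodule.
Variable P : submod.

Lemma submod0 : P 0. Proof. by case: (submodP P). Qed.
Lemma submodZD a u v : P u -> P v -> P (a *: u + v).
Proof. by case: (submodP P) => _; apply. Qed.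
Lemma submodD u v : P u -> P v -> P (u + v).
Proof. by move=> Pu Pv; rewrite -[u]scale1r; exact: submodZD. Qed.
Lemma submodZ a u : P u -> P (a *: u).
Proof. by move=> Pu; rewrite -[_ *: _]addr0; apply: submodZD submod0. Qed.
Lemma submodN u : P u -> P (- u).
Proof. by move=> Pu; rewrite -scaleN1r; exact: submodZ. Qed.

Definition submod_pred : {pred V} := fun x => `[< P x >].

Lemma submod_predP x : reflect (P x) (x \in submod_pred).
Proof. by rewrite unfold_in; exact: asboolP. Qed.

Lemma submod_pred_oppr_closed : oppr_closed submod_pred.
Proof. by move=> u /submod_predP Pu; apply/submod_predP; exact: submodN. Qed.

Lemma submod_pred_closed : submod_closed submod_pred.
Proof.
split=> [|a u v /submod_predP Pu /submod_predP Pv]; apply/submod_predP.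
  exact: submod0.
exact: submodZD.
Qed.

HB.instance Definition _ :=
  GRing.isSubmodClosed.Build R V submod_pred
    submod_pred_closed.
HB.instance Definition _ := GRing.isOppClosed.Build V submod_pred
    submod_pred_oppr_closed.

Record subm := Subm { subm_val : V; subm_valP : subm_val \in submod_pred }.
HB.instance Definition _ := [isSub for subm_val].
HB.instance Definition _ := [Choice of subm by <:].
HB.instance Definition _ := [SubChoice_isSubLmodule of subm by <:].

Definition quotm_rel (u v : V) : bool := `[< P (u - v) >].

Lemma quotm_rel_refl : reflexive quotm_rel.
Proof. by move=> u; apply/asboolP; rewrite subrr; exact: submod0. Qed.
Lemma quotm_rel_sym : symmetric quotm_rel.
Proof.
by move=> u v; apply/asboolP/asboolP => /submodN; rewrite opprB.
Qed.
Lemma quotm_rel_trans : transitive quotm_rel.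
Proof.
move=> v u w /asboolP uv /asboolP vw; apply/asboolP.
by have := submodD uv vw; rewrite addrA subrK.
Qed.
Canonical quotm_equiv :=
  EquivRel quotm_rel quotm_rel_refl quotm_rel_sym quotm_rel_trans.

Definition quotm := {eq_quot quotm_rel}.
HB.instance Definition _ : EqQuotient _ quotm_rel quotm := EqQuotient.on quotm.
HB.instance Definition _ := Choice.on quotm.

Definition quotm_pi (v : V) : quotm := \pi v.

Lemma quotm_piP u v : quotm_pi u = quotm_pi v <-> P (u - v).
Proof.
split=> [/eqquotP/asboolP //|Puv].
by apply/eqquotP/asboolP.
Qed.

Lemma quotm_reprK : cancel (fun x : quotm => repr x) quotm_pi.
Proof. exact: reprK. Qed.

Lemma quotm_piW (x : quotm) : exists v, x = quotm_pi v.
Proof. by exists (repr x); rewrite quotm_reprK. Qed.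

Definition quotm_add (x y : quotm) := quotm_pi (repr x + repr y).
Definition quotm_opp (x : quotm) := quotm_pi (- repr x).
Definition quotm_scale (a : R) (x : quotm) := quotm_pi (a *: repr x).

Lemma quotm_repr v : P (repr (quotm_pi v) - v).
Proof. by apply/quotm_piP; rewrite quotm_reprK. Qed.

Lemma quotm_addE u v : quotm_add (quotm_pi u) (quotm_pi v) = quotm_pi (u + v).
Proof.
by apply/quotm_piP; rewrite opprD addrACA; apply: submodD; exact: quotm_repr.
Qed.
Lemma quotm_oppE u : quotm_opp (quotm_pi u) = quotm_pi (- u).
Proof. by apply/quotm_piP; rewrite -opprD; apply: submodN; exact: quotm_repr. Qed.
Lemma quotm_scaleE a u : quotm_scale a (quotm_pi u) = quotm_pi (a *: u).
Proof.
by apply/quotm_piP; rewrite -scalerBr; apply: submodZ; exact: quotm_repr.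
Qed.

Lemma quotm_addA : associative quotm_add.
Proof.
move=> x y z; have [u ->] := quotm_piW x; have [v ->] := quotm_piW y.
by have [w ->] := quotm_piW z; rewrite !quotm_addE addrA.
Qed.
Lemma quotm_addC : commutative quotm_add.
Proof. by move=> x y; rewrite /quotm_add addrC. Qed.
Lemma quotm_add0 : left_id (quotm_pi 0) quotm_add.
Proof. by move=> x; have [u ->] := quotm_piW x; rewrite quotm_addE add0r. Qed.
Lemma quotm_addN : left_inverse (quotm_pi 0) quotm_opp quotm_add.
Proof.
by move=> x; have [u ->] := quotm_piW x; rewrite quotm_oppE quotm_addE addNr.
Qed.
HB.instance Definition _ :=
  GRing.isZmodule.Build quotm quotm_addA quotm_addC quotm_add0 quotm_addN.

Lemma quotm_piD u v : quotm_pi u + quotm_pi v = quotm_pi (u + v).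
Proof. exact: quotm_addE. Qed.

Lemma quotm_scaleA a b x :
  quotm_scale a (quotm_scale b x) = quotm_scale (a * b) x.
Proof. by have [u ->] := quotm_piW x; rewrite !quotm_scaleE scalerA. Qed.
Lemma quotm_scale1 : left_id 1 quotm_scale.
Proof. by move=> x; have [u ->] := quotm_piW x; rewrite quotm_scaleE scale1r. Qed.
Lemma quotm_scaleDr : right_distributive quotm_scale +%R.
Proof.
move=> a x y; have [u ->] := quotm_piW x; have [v ->] := quotm_piW y.
by rewrite quotm_piD !quotm_scaleE quotm_piD scalerDr.
Qed.
Lemma quotm_scaleDl x : {morph quotm_scale^~ x : a b / a + b}.
Proof.
move=> a b /=; have [u ->] := quotm_piW x.
by rewrite !quotm_scaleE quotm_piD scalerDl.
Qed.
HB.instance Definition _ := GRing.Zmodule_isLmodule.Build R quotm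
  quotm_scaleA quotm_scale1 quotm_scaleDr quotm_scaleDl.

Lemma quotm_pi_linear : linear quotm_pi.
Proof.
move=> a u v; rewrite -quotm_piD; congr (_ + _).
by rewrite -quotm_scaleE.
Qed.
HB.instance Definition _ :=
  GRing.isLinear.Build R V quotm _ quotm_pi quotm_pi_linear.

End OneSubmodule.
End Submodules.

(** ** Localization at the nonzero scalars *)

Section Localization.
Variable K : idomainType.

Record nzscal := NzScal { nzval :> K; nzvalP : nzval != 0 }.
HB.instance Definition _ := [isSub for nzval].
HB.instance Definition _ := [Choice of nzscal by <:].

Definition nz1 : nzscal := NzScal (oner_neq0 K).
Definition nzM (s t : nzscal) : nzscal :=
  NzScal (mulf_neq0 (nzvalP s) (nzvalP t)).

Section Module.
Variable V : lmodType K.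

Definition loc_rel (x y : V * nzscal) : bool :=
  `[< exists2 r : K, r != 0 & r *: (nzval y.2 *: x.1) = r *: (nzval x.2 *: y.1) >].

Lemma loc_rel_refl : reflexive loc_rel.
Proof. by move=> x; apply/asboolP; exists 1; rewrite ?oner_neq0. Qed.
Lemma loc_rel_sym : symmetric loc_rel.
Proof. by move=> x y; apply/asboolP/asboolP => -[r r0 e]; exists r. Qed.
Lemma loc_rel_trans : transitive loc_rel.
Proof.
move=> [w t] [v s] [u q] /asboolP[r r0 /= e] /asboolP[r' r'0 /= e'].
apply/asboolP; exists (nzval t * r * r'); first by rewrite !mulf_neq0 ?(nzvalP t).
have -> /= : nzval t * r * r' *: (nzval q *: v) =
    (nzval q * r') *: (r *: (nzval t *: v)) by rewrite !scalerA; congr (_ *: _); ring.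
rewrite e.
have -> : (nzval q * r') *: (r *: (nzval s *: w)) =
    (nzval s * r) *: (r' *: (nzval q *: w)) by rewrite !scalerA; congr (_ *: _); ring.
by rewrite e' !scalerA; congr (_ *: _); ring.
Qed.
Canonical loc_equiv := EquivRel loc_rel loc_rel_refl loc_rel_sym loc_rel_trans.

(* V_K = V (x) K, realized as the module of fractions v / s with s a nonzero
   element of the base domain *)
Definition loc := {eq_quot loc_rel}.
HB.instance Definition _ : EqQuotient _ loc_rel loc := EqQuotient.on loc.
HB.instance Definition _ := Choice.on loc.

Definition lfrac (v : V) (s : nzscal) : loc := \pi_loc (v, s).

Lemma lfracP v s w t : lfrac v s = lfrac w t <->
  exists2 r : K, r != 0 & r *: (nzval t *: v) = r *: (nzval s *: w).
Proof. by split=> [/eqquotP/asboolP//|e]; apply/eqquotP/asboolP. Qed.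

Lemma lfrac_eq v s w t : nzval t *: v = nzval s *: w -> lfrac v s = lfrac w t.
Proof. by move=> e; apply/lfracP; exists 1; rewrite ?oner_neq0 ?e. Qed.

Lemma lfrac_repr (x : loc) : lfrac (repr x).1 (repr x).2 = x.
Proof. by rewrite /lfrac -surjective_pairing reprK. Qed.

Lemma lfracW (x : loc) : exists v s, x = lfrac v s.
Proof. by exists (repr x).1, (repr x).2; rewrite lfrac_repr. Qed.

Definition loc_add (x y : loc) : loc :=
  lfrac (nzval (repr y).2 *: (repr x).1 + nzval (repr x).2 *: (repr y).1)
        (nzM (repr x).2 (repr y).2).
Definition loc_opp (x : loc) : loc := lfrac (- (repr x).1) (repr x).2.

Lemma loc_addE v s w t : loc_add (lfrac v s) (lfrac w t) =
  lfrac (nzval t *: v + nzval s *: w) (nzM s t).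
Proof.
rewrite /loc_add.
move: (lfrac_repr (lfrac v s)) (lfrac_repr (lfrac w t)).
move: (repr (lfrac v s)) (repr (lfrac w t)) => [v' s'] [w' t'] /= /lfracP[r r0 e] /lfracP[q q0 e'].
apply/lfracP; exists (r * q); first exact: mulf_neq0.
rewrite /= !scalerDr; congr (_ + _).
  transitivity ((q * nzval t * nzval t') *: (r *: (nzval s *: v'))).
    by rewrite !scalerA; congr (_ *: _); ring.
  by rewrite e !scalerA; congr (_ *: _); ring.
transitivity ((r * nzval s * nzval s') *: (q *: (nzval t *: w'))).
  by rewrite !scalerA; congr (_ *: _); ring.
by rewrite e' !scalerA; congr (_ *: _); ring.
Qed.

Lemma loc_oppE v s : loc_opp (lfrac v s) = lfrac (- v) s.
Proof.
rewrite /loc_opp; move: (lfrac_repr (lfrac v s)).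
move: (repr _) => [v' s'] /= /lfracP[r r0 e].
by apply/lfracP; exists r => //; rewrite !scalerN e.
Qed.

Lemma loc_addA : associative loc_add.
Proof.
move=> x y z; have [u [s ->]] := lfracW x; have [v [t ->]] := lfracW y.
have [w [q ->]] := lfracW z; rewrite !loc_addE; apply: lfrac_eq => /=.
by rewrite !scalerDr !scalerA addrA; congr (_ *: _ + _ *: _ + _ *: _); ring.
Qed.
Lemma loc_addC : commutative loc_add.
Proof.
move=> x y; have [u [s ->]] := lfracW x; have [v [t ->]] := lfracW y.
rewrite !loc_addE; apply: lfrac_eq => /=.
by rewrite addrC mulrC.
Qed.
Lemma loc_add0 : left_id (lfrac 0 nz1) loc_add.
Proof.
move=> x; have [u [s ->]] := lfracW x; rewrite loc_addE; apply: lfrac_eq => /=.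
by rewrite scaler0 add0r scale1r mul1r.
Qed.
Lemma loc_addN : left_inverse (lfrac 0 nz1) loc_opp loc_add.
Proof.
move=> x; have [u [s ->]] := lfracW x; rewrite loc_oppE loc_addE.
by apply: lfrac_eq; rewrite /= scalerN addNr !scaler0.
Qed.
HB.instance Definition _ :=
  GRing.isZmodule.Build loc loc_addA loc_addC loc_add0 loc_addN.

Lemma lfracD v s w t :
  lfrac v s + lfrac w t = lfrac (nzval t *: v + nzval s *: w) (nzM s t).
Proof. exact: loc_addE. Qed.

Lemma lfracDs v w s : lfrac v s + lfrac w s = lfrac (v + w) s.
Proof.
by rewrite lfracD; apply: lfrac_eq; rewrite /= -scalerDr scalerA.
Qed.

End Module.

(* the pairing (u / s, v / t) |-> f u v / (s t) induced by a bilinear f *)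
Section Bilinear.
Variables (U V W : lmodType K) (f : U -> V -> W).

Definition loc_pair (x : loc U) (y : loc V) : loc W :=
  lfrac (f (repr x).1 (repr y).1) (nzM (repr x).2 (repr y).2).

Definition bilinear_fun : Prop :=
  (forall y, linear (f ^~ y)) /\ (forall x, linear (f x)).

Hypothesis f_bil : bilinear_fun.

Lemma bil_Dl x x' y : f (x + x') y = f x y + f x' y.
Proof. by have := f_bil.1 y 1 x x'; rewrite !scale1r. Qed.
Lemma bil_Dr x y y' : f x (y + y') = f x y + f x y'.
Proof. by have := f_bil.2 x 1 y y'; rewrite !scale1r. Qed.
Lemma bil_0l y : f 0 y = 0.
Proof. by apply: (addrI (f 0 y)); rewrite -bil_Dl !addr0. Qed.
Lemma bil_0r x : f x 0 = 0.
Proof. by apply: (addrI (f x 0)); rewrite -bil_Dr !addr0. Qed.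
Lemma bil_Zl a x y : f (a *: x) y = a *: f x y.
Proof. by have := f_bil.1 y a x 0; rewrite !addr0 bil_0l addr0. Qed.
Lemma bil_Zr a x y : f x (a *: y) = a *: f x y.
Proof. by have := f_bil.2 x a y 0; rewrite !addr0 bil_0r addr0. Qed.

Lemma loc_pairE u s v t :
  loc_pair (lfrac u s) (lfrac v t) = lfrac (f u v) (nzM s t).
Proof.
rewrite /loc_pair.
move: (lfrac_repr (lfrac u s)) (lfrac_repr (lfrac v t)).
move: (repr (lfrac u s)) (repr (lfrac v t)) => [u' s'] [v' t'] /= /lfracP[r r0 e] /lfracP[q q0 e'].
apply/lfracP; exists (r * q); first exact: mulf_neq0.
transitivity (f (r *: (nzval s *: u')) (q *: (nzval t *: v'))).
  by rewrite !(bil_Zl, bil_Zr) !scalerA /=; congr (_ *: _); ring.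
rewrite e e' !(bil_Zl, bil_Zr) !scalerA /=; congr (_ *: _); ring.
Qed.

Lemma loc_pairDl x x' y : loc_pair (x + x') y = loc_pair x y + loc_pair x' y.
Proof.
have [u [s ->]] := lfracW x; have [u' [s' ->]] := lfracW x'.
have [v [t ->]] := lfracW y; rewrite lfracD !loc_pairE lfracD.
apply: lfrac_eq; rewrite /= bil_Dl !bil_Zl !scalerDr !scalerA.
by congr (_ *: _ + _ *: _); ring.
Qed.
Lemma loc_pairDr x y y' : loc_pair x (y + y') = loc_pair x y + loc_pair x y'.
Proof.
have [u [s ->]] := lfracW x; have [v [t ->]] := lfracW y.
have [v' [t' ->]] := lfracW y'; rewrite lfracD !loc_pairE lfracD.
apply: lfrac_eq; rewrite /= bil_Dr !bil_Zr !scalerDr !scalerA.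
by congr (_ *: _ + _ *: _); ring.
Qed.
End Bilinear.
End Localization.

(** ** The algebra H_K and the H_K-modules M_K *)

Section LocAlgebra.
Variables (K : idomainType) (H : algType K).

Definition loc_alg : Type := loc H.
HB.instance Definition _ := GRing.Zmodule.on loc_alg.

Lemma mul_bilinear : bilinear_fun (fun x y : H => x * y).
Proof.
split=> [y a u v|x a u v] /=; first by rewrite mulrDl scalerAl.
by rewrite mulrDr scalerAr.
Qed.

Definition loc_mul (x y : loc_alg) : loc_alg :=
  loc_pair (fun x y : H => x * y) x y.

Lemma loc_mulE u s v t :
  loc_mul (lfrac u s) (lfrac v t) = lfrac (u * v) (nzM s t).
Proof. exact: (loc_pairE mul_bilinear). Qed.

Lemma loc_mulA : associative loc_mul.
Proof.
move=> x y z; have [u [s ->]] := lfracW x; have [v [t ->]] := lfracW y.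
have [w [q ->]] := lfracW z; rewrite !loc_mulE; apply: lfrac_eq => /=.
by rewrite !mulrA.
Qed.
Lemma loc_mul1l : left_id (lfrac 1 (nz1 K) : loc_alg) loc_mul.
Proof.
move=> x; have [u [s ->]] := lfracW x; rewrite loc_mulE; apply: lfrac_eq => /=.
by rewrite !mul1r.
Qed.
Lemma loc_mul1r : right_id (lfrac 1 (nz1 K) : loc_alg) loc_mul.
Proof.
move=> x; have [u [s ->]] := lfracW x; rewrite loc_mulE; apply: lfrac_eq => /=.
by rewrite !mulr1.
Qed.
Lemma loc_mulDl : left_distributive loc_mul +%R.
Proof. by move=> x y z; exact: (loc_pairDl mul_bilinear). Qed.
Lemma loc_mulDr : right_distributive loc_mul +%R.
Proof. by move=> x y z; exact: (loc_pairDr mul_bilinear). Qed.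
HB.instance Definition _ := GRing.Zmodule_isPzRing.Build loc_alg
  loc_mulA loc_mul1l loc_mul1r loc_mulDl loc_mulDr.

Section LocModule.
Variable M : lmodType H^c.

(* M as a module over the base domain, by restriction of scalars *)
Definition resK : Type := M.
HB.instance Definition _ := GRing.Zmodule.on resK.

Definition resK_scale (k : K) (m : resK) : resK := (k%:A : H^c) *: (m : M).

Lemma resK_scaleA a b m :
  resK_scale a (resK_scale b m) = resK_scale (a * b) m.
Proof.
rewrite /resK_scale scalerA; congr (_ *: _).
by rewrite -[LHS]/((b%:A : H) * (a%:A : H)) -scalerAl mul1r scalerA mulrC.
Qed.
Lemma resK_scale1 : left_id 1 resK_scale.
Proof.
by move=> m; rewrite /resK_scale (scale1r (1 : H)); exact: (@scale1r H^c M).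
Qed.
Lemma resK_scaleDr : right_distributive resK_scale +%R.
Proof. by move=> a x y; exact: (@scalerDr H^c M). Qed.
Lemma resK_scaleDl m : {morph resK_scale^~ m : a b / a + b}.
Proof.
by move=> a b; rewrite /resK_scale (scalerDl (1 : H)); exact: (@scalerDl H^c M).
Qed.
HB.instance Definition _ := GRing.Zmodule_isLmodule.Build K resK
  resK_scaleA resK_scale1 resK_scaleDr resK_scaleDl.

Lemma resK_scaleE (k : K) (m : resK) : k *: m = (k%:A : H^c) *: (m : M).
Proof. by []. Qed.

Definition ract (h : H) (m : resK) : resK := (h : H^c) *: (m : M).

Lemma ract_bilinear : bilinear_fun ract.
Proof.
have sE (a : K) (x : H) (m : M) :
    (a%:A : H^c) *: ((x : H^c) *: m) = ((a *: x : H) : H^c) *: m.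
  rewrite scalerA; congr (_ *: _).
  by rewrite -[LHS]/((x : H) * (a%:A : H)) -scalerAr mulr1.
split=> [m a x y|x a m n].
  rewrite /ract resK_scaleE [RHS]/= (sE a x m); exact: (@scalerDl H^c M).
rewrite /ract resK_scaleE.
transitivity ((x : H^c) *: ((a%:A : H^c) *: (m : M)) + (x : H^c) *: (n : M)).
  exact: (@scalerDr H^c M).
congr (_ + _ : M); apply/esym/(etrans (sE a x m)); rewrite scalerA; congr (_ *: _).
by rewrite -[RHS]/((a%:A : H) * (x : H)) -scalerAl mul1r.
Qed.

Definition locM : Type := loc resK.
HB.instance Definition _ := GRing.Zmodule.on locM.

(* (m / t) (h / s) = (m h) / (t s) *)
Definition locM_scale (x : loc_alg^c) (m : locM) : locM :=
  loc_pair ract (x : loc H) m.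

Lemma locM_scaleE h s m t :
  locM_scale (lfrac h s) (lfrac m t) = lfrac ((h : H^c) *: (m : M) : resK) (nzM s t).
Proof. exact: (loc_pairE ract_bilinear). Qed.

Lemma locM_scaleA a b m :
  locM_scale a (locM_scale b m) = locM_scale (a * b) m.
Proof.
have [x [s ->]] := lfracW (a : loc H); have [y [t ->]] := lfracW (b : loc H).
have [n [q ->]] := lfracW m.
rewrite -[_ * _]/(loc_mul (lfrac y t) (lfrac x s)) loc_mulE !locM_scaleE.
apply: lfrac_eq => /=; rewrite scalerA; congr (_ *: _).
by rewrite [nzval t * _]mulrC !mulrA.
Qed.
Lemma locM_scale1 : left_id 1 locM_scale.
Proof.
move=> m; have [n [q ->]] := lfracW m.
rewrite -[1]/(lfrac (1 : H) (nz1 K)) locM_scaleE; apply: lfrac_eq => /=.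
by rewrite mul1r scale1r.
Qed.
Lemma locM_scaleDr : right_distributive locM_scale +%R.
Proof. by move=> a x y; exact: (loc_pairDr ract_bilinear). Qed.
Lemma locM_scaleDl m : {morph locM_scale^~ m : a b / a + b}.
Proof. by move=> a b; exact: (loc_pairDl ract_bilinear). Qed.
HB.instance Definition _ := GRing.Zmodule_isLmodule.Build (loc_alg^c) locM
  locM_scaleA locM_scale1 locM_scaleDr locM_scaleDl.

Definition to_loc (m : M) : locM := lfrac (m : resK) (nz1 K).

End LocModule.
End LocAlgebra.

Section LocAlgebraTheory.
Variables (K : idomainType) (H : algType K).

Lemma to_loc_lin (M : lmodType H^c) (h : H^c) (m n : M) :
  to_loc (h *: m + n) = (lfrac (h : H) (nz1 K) : (loc_alg H)^c) *: to_loc m + to_loc n.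
Proof.
rewrite -[_ *: _ in RHS]/(locM_scale _ _) locM_scaleE [RHS]lfracD.
apply: lfrac_eq => /=.
by rewrite !mul1r !(scale1r (_ : resK M)).
Qed.

Lemma to_loc0 (M : lmodType H^c) : to_loc (0 : M) = 0.
Proof. by []. Qed.

Section LocMap.
Variables (M N : lmodType H^c) (f : {linear M -> N}).

Definition loc_map (x : locM M) : locM N :=
  lfrac (f (repr (x : loc (resK M))).1 : resK N) (repr (x : loc (resK M))).2.

Lemma loc_mapE (m : M) s :
  loc_map (lfrac (m : resK M) s) = lfrac (f m : resK N) s.
Proof.
rewrite /loc_map; move: (lfrac_repr (lfrac (m : resK M) s)).
case: (repr _) => m' s' /= /lfracP[r r0 e]; apply/lfracP; exists r => //.
rewrite !resK_scaleE in e *; rewrite -!linearZ_LR; congr (f _); exact: e.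
Qed.

Lemma loc_map_linear : linear loc_map.
Proof.
move=> a x y; have [h [s ->]] := lfracW (a : loc H).
have [m [t ->]] := lfracW x; have [n [q ->]] := lfracW y.
rewrite -[_ *: _ in LHS]/(locM_scale _ _) locM_scaleE lfracD !loc_mapE.
rewrite -[_ *: _ in RHS]/(locM_scale _ _) locM_scaleE [RHS]lfracD.
congr (lfrac _ _); rewrite !resK_scaleE.
by rewrite linearD !linearZ_LR.
Qed.
HB.instance Definition _ := GRing.isLinear.Build (loc_alg H)^c (locM M) (locM N)
  _ loc_map loc_map_linear.

Lemma loc_map_to_loc m : loc_map (to_loc m) = to_loc (f m).
Proof. exact: loc_mapE. Qed.

End LocMap.
End LocAlgebraTheory.

(** ** Finiteness, irreducibility, semisimplicity *)

Definition fin_gen (R : pzRingType) (V : lmodType R) : Prop :=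
  exists (n : nat) (e : 'I_n -> V), forall v, exists c : 'I_n -> R,
    v = \sum_i c i *: e i.

Definition noetherian (R : comPzRingType) : Prop :=
  forall I : submod R^o, fin_gen (subm I).

Definition torsion_free (K : idomainType) (V : lmodType K) : Prop :=
  forall (k : K) (v : V), k *: v = 0 -> k = 0 \/ v = 0.

Section Modules.
Variable R : pzRingType.
Implicit Types L M N P V W X Y Z : lmodType R.

Definition isom M N : Prop := exists f : {linear M -> N}, bijective f.

Definition irreducible V : Prop :=
  (exists v : V, v <> 0) /\
  forall U : set V, submodule U ->
    (forall v, U v -> v = 0) \/ (forall v, U v).

(* The irreducible submodules U of V such that T holds for U viewed as a module
   of its own, i.e. the images of the embeddings into V of the irreducible
   modules satisfying T *)
Definition irr_submod (T : lmodType R -> Prop) V : set (set V) :=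
  [set U | exists L (f : {linear L -> V}),
     [/\ irreducible L, T L, injective f & U = range f]].
Arguments irr_submod : clear implicits.

Definition semisimple V : Prop :=
  sum_submod (irr_submod (fun=> True) V) = setT.

(* V is the direct sum of the L k, with injections i k and projections p k *)
Definition direct_sum n (L : 'I_n -> lmodType R) V : Prop :=
  exists (i : forall k, {linear L k -> V}) (p : forall k, {linear V -> L k}),
    [/\ forall k x, p k (i k x) = x,
        forall j k x, j != k -> p j (i k x) = 0 &
        forall v, \sum_k i k (p k v) = v].

Definition biproduct M P N (i1 : {linear M -> N}) (p1 : {linear N -> M})
    (i2 : {linear P -> N}) (p2 : {linear N -> P}) : Prop :=
  [/\ forall x, p1 (i1 x) = x, forall y, p2 (i2 y) = y,
      forall x, p2 (i1 x) = 0, forall y, p1 (i2 y) = 0 &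
      forall z, i1 (p1 z) + i2 (p2 z) = z].

Definition short_exact M N P (f : {linear M -> N}) (g : {linear N -> P}) : Prop :=
  [/\ injective f, forall y, g y = 0 <-> exists x, f x = y &
      forall z, exists y, g y = z].

Definition split_exact M N P (f : {linear M -> N}) (g : {linear N -> P}) : Prop :=
  short_exact f g /\ exists s : {linear P -> N}, forall z, g (s z) = z.

Lemma irr_submod_map T V W (g : {linear V -> W}) v :
  sum_submod (irr_submod T V) v -> sum_submod (irr_submod T W) (g v).
Proof.
have [sub0 subD] := sum_submodP (irr_submod T W).
apply: (smallest_sub (X := g @^-1` sum_submod (irr_submod T W))).
  split=> [|a x y gx gy]; first by rewrite /preimage /= linear0.
  by rewrite /preimage /= linearP; exact: subD.
move=> x [U [L [f [irrL TL inj_f ->]]]] [y _ <-]; rewrite /preimage /=.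
have kerP : submodule [set z : L | g (f z) = 0].
  split=> [|a u w /= u0 w0]; first by rewrite /= !linear0.
  by rewrite /= !linearP u0 w0 scaler0 addr0.
have [inj_gf|gf0] := irrL.2 _ kerP; last first.
  by have /= -> := gf0 y; exact: sub0.
move=> U' [_ FU']; apply: FU'; exists (range (g \o f)); last by exists y.
exists L, (g \o f); split => // a b /= /eqP; rewrite -subr_eq0 -!linearB => /eqP.
by move/inj_gf/eqP; rewrite subr_eq0 => /eqP.
Qed.

(** ** Exact categories of modules

    A full subcategory of the category of R-modules is given by a predicate A on
    modules; a class of sequences M -> N -> P by a predicate E. *)

Definition sequences : Type :=
  forall M N P, {linear M -> N} -> {linear N -> P} -> Prop.

Definition inflation (E : sequences) M N (f : {linear M -> N}) : Prop :=
  exists P (g : {linear N -> P}), E M N P f g.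

Definition deflation (E : sequences) N P (g : {linear N -> P}) : Prop :=
  exists M (f : {linear M -> N}), E M N P f g.

Section FullSubcategory.
Variable A : lmodType R -> Prop.

Definition iso_closed : Prop := forall M N, A M -> isom M N -> A N.

Definition additive_category : Prop :=
  (exists Z, A Z /\ forall z : Z, z = 0) /\
  forall M P, A M -> A P -> exists N, A N /\
    exists (i1 : {linear M -> N}) (p1 : {linear N -> M})
           (i2 : {linear P -> N}) (p2 : {linear N -> P}), biproduct i1 p1 i2 p2.

(* kernels, cokernels, pullbacks and pushouts in the full subcategory A *)
Definition is_kernel M N P (f : {linear M -> N}) (g : {linear N -> P}) : Prop :=
  (forall x, g (f x) = 0) /\
  forall X (u : {linear X -> N}), A X -> (forall x, g (u x) = 0) ->
    exists w : {linear X -> M}, (forall x, f (w x) = u x) /\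
      forall w' : {linear X -> M}, (forall x, f (w' x) = u x) -> w' =1 w.

Definition is_cokernel M N P (f : {linear M -> N}) (g : {linear N -> P}) : Prop :=
  (forall x, g (f x) = 0) /\
  forall X (u : {linear N -> X}), A X -> (forall x, u (f x) = 0) ->
    exists w : {linear P -> X}, (forall y, w (g y) = u y) /\
      forall w' : {linear P -> X}, (forall y, w' (g y) = u y) -> w' =1 w.

Definition is_pullback N P P' N' (g : {linear N -> P}) (h : {linear P' -> P})
    (h' : {linear N' -> N}) (g' : {linear N' -> P'}) : Prop :=
  (forall x, g (h' x) = h (g' x)) /\
  forall X (u : {linear X -> N}) (v : {linear X -> P'}), A X ->
    (forall x, g (u x) = h (v x)) ->
    exists w : {linear X -> N'},
      ((forall x, h' (w x) = u x) /\ (forall x, g' (w x) = v x)) /\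
      forall w' : {linear X -> N'},
        (forall x, h' (w' x) = u x) -> (forall x, g' (w' x) = v x) -> w' =1 w.

Definition is_pushout M N M' N' (f : {linear M -> N}) (h : {linear M -> M'})
    (h' : {linear N -> N'}) (f' : {linear M' -> N'}) : Prop :=
  (forall x, h' (f x) = f' (h x)) /\
  forall X (u : {linear N -> X}) (v : {linear M' -> X}), A X ->
    (forall x, u (f x) = v (h x)) ->
    exists w : {linear N' -> X},
      ((forall y, w (h' y) = u y) /\ (forall y, w (f' y) = v y)) /\
      forall w' : {linear N' -> X},
        (forall y, w' (h' y) = u y) -> (forall y, w' (f' y) = v y) -> w' =1 w.

(* Quillen's axioms, without the one on deflations (inflations) that have a
   kernel (cokernel), which Keller showed to follow from the others *)
Record exact_category (E : sequences) : Prop := ExactCategory {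
  ec_additive : additive_category;
  ec_obj : forall M N P (f : {linear M -> N}) (g : {linear N -> P}),
    E M N P f g -> [/\ A M, A N & A P];
  ec_kernel_cokernel : forall M N P (f : {linear M -> N}) (g : {linear N -> P}),
    E M N P f g -> is_kernel f g /\ is_cokernel f g;
  ec_iso : forall M N P (f : {linear M -> N}) (g : {linear N -> P})
      M' N' P' (f' : {linear M' -> N'}) (g' : {linear N' -> P'})
      (a : {linear M -> M'}) (b : {linear N -> N'}) (c : {linear P -> P'}),
    E M N P f g -> A M' -> A N' -> A P' ->
    bijective a -> bijective b -> bijective c ->
    (forall x, b (f x) = f' (a x)) -> (forall y, c (g y) = g' (b y)) ->
    E M' N' P' f' g';
  ec_split : forall M P N (i1 : {linear M -> N}) (p1 : {linear N -> M})
      (i2 : {linear P -> N}) (p2 : {linear N -> P}),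
    A M -> A P -> A N -> biproduct i1 p1 i2 p2 -> E M N P i1 p2;
  ec_inflation_comp : forall M N P (f : {linear M -> N}) (g : {linear N -> P}),
    inflation E f -> inflation E g -> inflation E (g \o f);
  ec_deflation_comp : forall M N P (f : {linear M -> N}) (g : {linear N -> P}),
    deflation E f -> deflation E g -> deflation E (g \o f);
  ec_pullback : forall N P P' (g : {linear N -> P}) (h : {linear P' -> P}),
    deflation E g -> A P' ->
    exists N' (h' : {linear N' -> N}) (g' : {linear N' -> P'}),
      [/\ A N', is_pullback g h h' g' & deflation E g'];
  ec_pushout : forall M N M' (f : {linear M -> N}) (h : {linear M -> M'}),
    inflation E f -> A M' ->
    exists N' (h' : {linear N -> N'}) (f' : {linear M' -> N'}),
      [/\ A N', is_pushout f h h' f' & inflation E f'] }.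

End FullSubcategory.

Definition full_exact_subcategory (A' : lmodType R -> Prop) (E' : sequences)
    (A : lmodType R -> Prop) (E : sequences) : Prop :=
  [/\ exact_category A' E', forall M, A' M -> A M &
      forall M N P (f : {linear M -> N}) (g : {linear N -> P}),
        E' M N P f g -> E M N P f g].

(** ** Extensions *)

Record extension Y Z := Extension {
  ext_mid : lmodType R;
  ext_inc : {linear Z -> ext_mid};
  ext_proj : {linear ext_mid -> Y} }.

Definition ext_in (E : sequences) Y Z (e : extension Y Z) : Prop :=
  E _ _ _ (ext_inc e) (ext_proj e).

Definition ext_equiv Y Z (e e' : extension Y Z) : Prop :=
  exists phi : {linear ext_mid e -> ext_mid e'},
    [/\ bijective phi, forall z, phi (ext_inc e z) = ext_inc e' z &
        forall x, ext_proj e' (phi x) = ext_proj e x].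

(* the equivalence class of e, as a predicate *)
Definition ext_class (E : sequences) Y Z (e : extension Y Z) : extension Y Z -> Prop :=
  fun e' => ext_in E e' /\ ext_equiv e e'.

(* the underlying collection of Ext^1_E (Y, Z): the equivalence classes of the
   sequences Z -> X -> Y in E *)
Definition Ext1 (E : sequences) Y Z (C : extension Y Z -> Prop) : Prop :=
  exists2 e, ext_in E e & C = ext_class E e.

Definition pair_inl Z Y (z : Z) : (Z * Y)%type := (z, 0).
Lemma pair_inl_linear Z Y : linear (@pair_inl Z Y).
Proof.
by move=> a u v; rewrite /pair_inl -[RHS]/(a *: u + v, a *: 0 + 0) scaler0 addr0.
Qed.
HB.instance Definition _ Z Y :=
  GRing.isLinear.Build R Z (Z * Y)%type _ (@pair_inl Z Y) (@pair_inl_linear Z Y).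

Definition split_extension Y Z : extension Y Z :=
  @Extension Y Z (Z * Y)%type (@pair_inl Z Y) snd.

(* the zero element of the module Ext^1 is the class of the split extension *)
Definition Ext1_eq0 (E : sequences) Y Z : Prop :=
  forall C, Ext1 E C <-> C = ext_class E (split_extension Y Z).

End Modules.
Arguments irr_submod {R} T V.

(** ** The height filtration *)

Section HeightFiltration.
Variables (K : idomainType) (H : algType K).
Local Notation HK := (loc_alg H).
Implicit Types M N P : lmodType H^c.

(* a positive function on the set of isomorphism classes of irreducible
   H_K-modules; only the values of ht at irreducible modules are relevant *)
Definition height_function (ht : lmodType HK^c -> int) : Prop :=
  (forall L L' : lmodType HK^c, irreducible L -> irreducible L' ->
     isom L L' -> ht L = ht L') /\
  (forall L : lmodType HK^c, irreducible L -> 0 < ht L).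

Variable ht : lmodType HK^c -> int.

Definition height_le (h : int) (V : lmodType HK^c) : set V :=
  sum_submod (irr_submod (fun L => ht L <= h) V).
Arguments height_le : clear implicits.

Definition filt_set h M : set M := [set m | height_le h (locM M) (to_loc m)].
Arguments filt_set : clear implicits.

Lemma filt_submodule h M : submodule (filt_set h M).
Proof.
have [s0 sD] := sum_submodP (irr_submod (fun L => ht L <= h) (locM M)).
split=> [|a u v su sv]; first by rewrite /filt_set /= to_loc0; exact: s0.
by rewrite /filt_set /= to_loc_lin; exact: sD.
Qed.

Definition filt h M : submod M := Submod (filt_submodule h M).

Definition Fil h M := subm (filt h M).
HB.instance Definition _ h M := GRing.Lmodule.on (Fil h M).

Lemma height_le_mono h h' (V : lmodType HK^c) :
  h <= h' -> height_le h V `<=` height_le h' V.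
Proof.
move=> hh'; apply: sub_smallest2r; first exact: sum_submodP.
move=> v [U [L [f [irrL TL inj_f eU]]] Uv]; exists U => //.
by exists L, f; split=> //; exact: le_trans hh'.
Qed.

Lemma filt_mono h h' M m : h <= h' -> filt h M m -> filt h' M m.
Proof. by move=> hh'; exact: height_le_mono. Qed.

Lemma filt_stable h M N (f : {linear M -> N}) m : filt h M m -> filt h N (f m).
Proof.
by rewrite /filt /filt_set /= -loc_map_to_loc; exact: irr_submod_map.
Qed.

Lemma Fil_map_subproof h M N (f : {linear M -> N}) (x : Fil h M) :
  f (subm_val x) \in submod_pred (filt h N).
Proof.
apply/submod_predP; apply: filt_stable; exact: elimT (submod_predP _ _) (subm_valP x).
Qed.

(* f^h : M^h -> N^h, the restriction of f *)
Definition Fil_map h M N (f : {linear M -> N}) (x : Fil h M) : Fil h N :=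
  Subm (Fil_map_subproof f x).
Lemma Fil_map_linear h M N (f : {linear M -> N}) : linear (@Fil_map h M N f).
Proof. by move=> a x y; apply: val_inj; rewrite /= !linearP. Qed.
HB.instance Definition _ h M N (f : {linear M -> N}) :=
  GRing.isLinear.Build H^c (Fil h M) (Fil h N) _ (Fil_map f) (Fil_map_linear f).

Lemma Fil_incl_subproof h M (x : Fil (h - 1) M) : subm_val x \in submod_pred (filt h M).
Proof.
by apply/submod_predP; apply: filt_mono (elimT (submod_predP _ _) (subm_valP x)); lia.
Qed.

(* the inclusion M^{h-1} -> M^h *)
Definition Fil_incl h M (x : Fil (h - 1) M) : Fil h M := Subm (Fil_incl_subproof x).
Lemma Fil_incl_linear h M : linear (@Fil_incl h M).
Proof. by move=> a x y; exact: val_inj. Qed.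
HB.instance Definition _ h M :=
  GRing.isLinear.Build H^c (Fil (h - 1) M) (Fil h M) _ (@Fil_incl h M)
    (@Fil_incl_linear h M).

Definition prev_set h M : set (Fil h M) := [set x | filt (h - 1) M (subm_val x)].
Arguments prev_set : clear implicits.
Lemma prev_submodule h M : submodule (prev_set h M).
Proof.
split=> [|a u v su sv]; first exact: submod0 (filt (h - 1) M).
exact: (@submodZD _ _ (filt (h - 1) M)).
Qed.
Definition prev h M : submod (Fil h M) := Submod (prev_submodule h M).

(* M^h / M^{h-1} *)
Definition Gr h M := quotm (prev h M).
HB.instance Definition _ h M := GRing.Lmodule.on (Gr h M).

Definition Gr_proj h M (x : Fil h M) : Gr h M := quotm_pi (prev h M) x.
Lemma Gr_proj_linear h M : linear (@Gr_proj h M).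
Proof. exact: (quotm_pi_linear (prev h M)). Qed.
HB.instance Definition _ h M :=
  GRing.isLinear.Build H^c (Fil h M) (Gr h M) _ (@Gr_proj h M) (@Gr_proj_linear h M).

Definition Gr_map h M N (f : {linear M -> N}) (x : Gr h M) : Gr h N :=
  Gr_proj (Fil_map f (repr x)).

Lemma Gr_mapE h M N (f : {linear M -> N}) (x : Fil h M) :
  Gr_map f (Gr_proj x) = Gr_proj (Fil_map f x).
Proof.
apply/quotm_piP; rewrite -linearB; apply: filt_stable.
exact: (quotm_repr (prev h M) x).
Qed.

Lemma Gr_map_linear h M N (f : {linear M -> N}) : linear (@Gr_map h M N f).
Proof.
move=> a x y; have [u ->] := quotm_piW x; have [v ->] := quotm_piW y.
by rewrite -!/(Gr_proj _) -linearP !Gr_mapE !linearP.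
Qed.
HB.instance Definition _ h M N (f : {linear M -> N}) :=
  GRing.isLinear.Build H^c (Gr h M) (Gr h N) _ (Gr_map f) (Gr_map_linear f).

(** ** The exact category of a family of subcategories *)

(* Each S i is a full additive subcategory, and its objects become sums of
   irreducibles of height i over H_K; if i is not a height then S_K = 0, so that
   S i has zero objects only. *)
Definition strata (S : int -> lmodType H^c -> Prop) : Prop :=
  forall i, [/\ additive_category (S i), iso_closed (S i) &
    forall M, S i M ->
      [/\ fin_gen (resK M), torsion_free (resK M) &
          exists n (L : 'I_n -> lmodType HK^c),
            (forall k, irreducible (L k) /\ ht (L k) = i) /\
            direct_sum L (locM M)]].

(* The category A(S) and the class E(S) of short exact sequences *)
Definition AS (S : int -> lmodType H^c -> Prop) M : Prop :=
  [/\ fin_gen (resK M), torsion_free (resK M) & forall h, S h (Gr h M)].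

Definition ES (S : int -> lmodType H^c -> Prop) : sequences H^c :=
  fun M N P f g =>
    [/\ AS S M, AS S N, AS S P, short_exact f g &
        forall h, split_exact (Gr_map (h := h) f) (Gr_map (h := h) g)].

End HeightFiltration.
Arguments height_le {K H} ht h V.
Arguments filt_set {K H} ht h M.
Arguments prev_set {K H} ht h M.

(* Main.v *)
Require Import Defs.
From HB Require Import structures.
From mathcomp Require Import all_boot all_order all_algebra.
From mathcomp Require Import zify.
From mathcomp Require Import boolp classical_sets.

(** Extensions in E of an object of S_a by X split when X^{a-1} = 0, since then
    the quotient embeds in the a-th layer, where the sequence splits; in
    particular Ext^1(S_a, S_h) = 0 for a <= h.  So enlarging X by an inflation
    with cokernel in S_h never creates extensions by S_a for a <= h, and it
    leaves X^k unchanged for k < h.  It remains to make Ext^1(S_h, -) vanish for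
    each h above the least height of M in turn, up to the bound on the heights
    (for smaller h it already vanishes on M).  As the members of F(h) need not belong to S_h, an
    extension of an object of S_h is restricted to its summands from F(h): the
    classes arising over such a summand F lie in a Noetherian K-module, so
    finitely many extensions generate them, and pushing out along these kills
    them all. *)

Set Implicit Arguments.
Unset Strict Implicit.
Unset Printing Implicit Defensive.

Import Order.TTheory GRing.Theory Num.Theory.
Local Open Scope ring_scope.

(** * Submodules spanned by a subset; Noetherian modules *)

Section Span.
Local Open Scope classical_set_scope.
Variables (R : pzRingType) (V : lmodType R).

Lemma submodule_sub (U : set V) u v : submodule U -> U u -> U v -> U (u - v).
Proof.
move=> sU Uu Uv.
exact: (@submodD _ _ (Submod sU) _ _ Uu (@submodN _ _ (Submod sU) _ Uv)).
Qed.

Lemma submodule_sum (U : set V) n (c : 'I_n -> R) (e : 'I_n -> V) :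
  submodule U -> (forall i, U (e i)) -> U (\sum_i c i *: e i).
Proof.
move=> [U0 UD] Ue; elim/big_ind: _ => // [u v Uu Uv|i _].
  by rewrite -[u]scale1r; exact: UD.
by rewrite -[_ *: _]addr0; exact: UD.
Qed.

Definition submod_span (T : set V) : set V := smallest (@submodule R V) T.

Lemma submod_spanP T : submodule (submod_span T).
Proof.
split=> [W [[W0 _] _] //|a u v su sv W FW].
by case: (FW) => -[_ WD] _; apply: WD; [exact: su|exact: sv].
Qed.

Lemma mem_submod_span (T : set V) v : T v -> submod_span T v.
Proof. by move=> Tv W [_]; apply. Qed.

Lemma submod_span_min (T U : set V) v :
  submodule U -> (forall t, T t -> U t) -> submod_span T v -> U v.
Proof. by move=> sU TU; apply; split. Qed.

Lemma submod_span_mono (T T' : set V) v :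
  (forall t, T t -> T' t) -> submod_span T v -> submod_span T' v.
Proof.
move=> TT'; apply: submod_span_min (submod_spanP _) _ => t.
by move=> /TT'/mem_submod_span.
Qed.

Lemma submod_span_finite (T : set V) v : submod_span T v ->
  exists2 s : seq V, (forall t, t \in s -> T t) & submod_span [set` s] v.
Proof.
apply: (submod_span_min (U := [set v | exists2 s : seq V,
    (forall t, t \in s -> T t) & submod_span [set` s] v])) => [|t Tt]; last first.
  exists [:: t] => [x|]; first by rewrite inE => /eqP->.
  by apply: mem_submod_span; rewrite /= inE.
split=> [|a u w [s sT su] [s' s'T s'w]].
  by exists [::] => //; case: (submod_spanP [set` [::] : seq V]).
exists (s ++ s') => [t|]; first by rewrite mem_cat => /orP[/sT|/s'T].
by apply: (submod_spanP _).2;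
    [apply: submod_span_mono su|apply: submod_span_mono s'w];
  move=> t /= ts; rewrite mem_cat ts ?orbT.
Qed.

Lemma fin_gen_submod_span : fin_gen V ->
  exists s : seq V, forall v, submod_span [set` s] v.
Proof.
move=> [n [e eP]]; exists (codom e) => v; have [c ->] := eP v.
apply: submodule_sum (submod_spanP _) _ => i.
by apply: mem_submod_span; exact: codom_f.
Qed.

End Span.

Section FiniteFunctions.
Local Open Scope classical_set_scope.

(** The functions [d l x], with value x at l and 0 elsewhere, generate when x runs over e. *)
Lemma submod_span_ffun (R : pzRingType) (V : lmodType R) (n : nat) (e : seq V) :
  (forall v, submod_span [set` e] v) ->
  exists s : seq {ffun 'I_n -> V}, forall v, submod_span [set` s] v.
Proof.
move=> eP; pose d l x : {ffun 'I_n -> V} := [ffun l' => if l' == l then x else 0].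
exists [seq d l x | l <- enum 'I_n, x <- e] => v.
set D := [set` _]; have [D0 DD] := submod_spanP D.
have -> : v = \sum_l 1 *: d l (v l).
  apply/ffunP => l; rewrite sum_ffunE (bigD1 l) //= !ffunE eqxx scale1r.
  rewrite big1 ?addr0// => l' /negPf; rewrite eq_sym !ffunE => ->.
  by rewrite scaler0.
apply: submodule_sum (submod_spanP _) _ => l.
move: (eP (v l)); apply: (submod_span_min (U := [set x | submod_span D (d l x)])).
  split=> [|a x y /= Dx Dy] /=.
    by rewrite (_ : d l 0 = 0)//; apply/ffunP => l'; rewrite !ffunE; case: ifP.
  rewrite (_ : d l _ = a *: d l x + d l y); first exact: DD.
  by apply/ffunP => l'; rewrite !ffunE; case: ifP; rewrite ?scaler0 ?addr0.
move=> x xe; apply: mem_submod_span; rewrite /D /=.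
by apply: allpairs_f => //; rewrite mem_enum.
Qed.

End FiniteFunctions.

Section Noetherian.
Local Open Scope classical_set_scope.
Variables (K : comPzRingType) (V : lmodType K).
Hypothesis noethK : noetherian K.

(** Induction on e. The coefficients of e0 in elements of U, taken modulo the span of the remaining
    generators, form an ideal I. Elements of U lifting finitely many generators of I, together with
    generators of the part of U inside that span, generate U. *)
Lemma noetherian_submodule (e : seq V) (U : set V) :
  submodule U -> (forall u, U u -> submod_span [set` e] u) ->
  exists2 s : seq V, (forall t, t \in s -> U t) &
    forall u, U u -> submod_span [set` s] u.
Proof.
elim: e U => [|e0 e IHe] U sU Ue; first by exists [::].
have [e'0 e'D] := submod_spanP [set` e].
have [U0 UD] := sU.
pose I := [set c : K^o | exists2 u, U u & submod_span [set` e] (u - c *: e0)].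
have sI : submodule I.
  split; first by exists 0; rewrite // scale0r subrr.
  move=> a c d [u Uu eu] [v Uv ev]; exists (a *: u + v); first exact: UD.
  rewrite scalerDl opprD addrACA -scalerA -scalerBr; exact: e'D.
have [m [g gP]] := noethK (Submod sI).
have {gP} gI (c : K) : I c ->
      exists b : 'I_m -> K, c = \sum_i b i * subm_val (g i).
  move=> Ic.
  have cI : (c : K^o) \in submod_pred (Submod sI) by apply/submod_predP.
  have [b /(congr1 (@subm_val _ _ _)) /= cE] := gP (Subm cI); exists b.
  by rewrite [LHS]cE -[subm_val _]/(\val _) raddf_sum.
have /choice[u uP] (i : 'I_m) :
    exists u, U u /\ submod_span [set` e] (u - (subm_val (g i) : K) *: e0).
  by have /submod_predP[u] := subm_valP (g i); exists u.
have sU' : submodule [set v | U v /\ submod_span [set` e] v].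
  by split=> // a v w [? ?] [? ?]; split; [exact: UD|exact: e'D].
have [|s sP s_gen] := IHe _ sU'; first by move=> v [].
exists (s ++ codom u) => [t|v Uv].
  by rewrite mem_cat => /orP[/sP[]//|/codomP[i ->]]; case: (uP i).
have [c vc] : exists c : K, submod_span [set` e] (v - c *: e0).
  move: (Ue v Uv).
  apply: (submod_span_min
    (U := [set x | exists c : K, submod_span [set` e] (x - c *: e0)])).
    split; first by exists 0; rewrite scale0r subrr.
    move=> a x y [c xc] [d yd]; exists (a * c + d).
    by rewrite scalerDl opprD addrACA -scalerA -scalerBr; exact: e'D.
  move=> t; rewrite /= inE => /orP[/eqP->|te].
    by exists 1; rewrite scale1r subrr.
  by exists 0; rewrite scale0r subr0; exact: mem_submod_span.
have [b cE] : exists b : 'I_m -> K, c = \sum_i b i * subm_val (g i).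
  by apply: gI; exists v.
pose w := \sum_i b i *: u i.
have Uw : U w by apply: submodule_sum => // i; case: (uP i).
rewrite -(subrK w v) -[_ - w]scale1r; apply: (submod_spanP _).2.
  apply: (@submod_span_mono _ _ [set` s]) => [t /= ts|].
    by rewrite mem_cat ts.
  apply: s_gen; split; first exact: submodule_sub.
  have -> : v - w =
      (v - c *: e0) - \sum_i b i *: (u i - (subm_val (g i) : K) *: e0).
    rewrite (eq_bigr _ (fun i _ => scalerBr _ _ _)) sumrB.
    rewrite (eq_bigr _ (fun i _ => scalerA _ _ _)) -scaler_suml -cE.
    by rewrite opprB addrA subrK.
  apply: submodule_sub vc _; first exact: submod_spanP.
  by apply: submodule_sum (submod_spanP _) _ => i; case: (uP i).
apply: submodule_sum (submod_spanP _) _ => i; apply: mem_submod_span => /=.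
by rewrite mem_cat codom_f orbT.
Qed.

(** T is not assumed to be a submodule, yet the generators are found in T itself: each generator of
    the span of T involves only finitely many elements of T. For obstructions this matters, since
    only a member of T comes with an actual extension. *)
Lemma noetherian_subset (e : seq V) (T : set V) :
  (forall v, submod_span [set` e] v) ->
  exists2 s : seq V, (forall t, t \in s -> T t) &
    forall t, T t -> submod_span [set` s] t.
Proof.
move=> eP.
have [|s sT sP] := @noetherian_submodule e _ (submod_spanP T); first by [].
have [s' s'T s'P] : exists2 s' : seq V, (forall t, t \in s' -> T t) &
    forall t, t \in s -> submod_span [set` s'] t.
  elim: s sT {sP} => [|x s IHs] sT; first by exists [::].
  have [|s' s'T s'P] := IHs; first by move=> t ts; apply: sT; rewrite inE ts orbT.
  have [|s1 s1T s1x] := @submod_span_finite _ _ T x.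
    by apply: sT; rewrite mem_head.
  exists (s1 ++ s') => [t|t]; first by rewrite mem_cat => /orP[/s1T|/s'T].
  rewrite inE => /orP[/eqP->|/s'P]; last apply: submod_span_mono.
    by apply: submod_span_mono s1x => y /= ys; rewrite mem_cat ys.
  by move=> y /= ys; rewrite mem_cat ys orbT.
exists s' => // t /mem_submod_span/sP; exact: submod_span_min (submod_spanP _) s'P.
Qed.

End Noetherian.

(** * Linear maps and presentations *)

Section LinearMaps.
Local Open Scope classical_set_scope.
Variable R : pzRingType.
Implicit Types F L M N P X Y : lmodType R.

Lemma linear_mk M N (f : M -> N) : linear f -> exists g : {linear M -> N}, g =1 f.
Proof.
move=> lf; have isL := GRing.isLinear.Build R M N _ f lf.
pose g : {linear M -> N} := HB.pack f isL.
by exists g.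
Qed.

Lemma inj_surj_bij M N (f : M -> N) :
  injective f -> (forall y, exists x, f x = y) -> bijective f.
Proof. by move=> inj_f /choice[g fg]; exists g => // x; apply: inj_f. Qed.

Lemma linear_inj0 M N (f : {linear M -> N}) :
  (forall x, f x = 0 -> x = 0) -> injective f.
Proof.
move=> f0 x y /eqP; rewrite -subr_eq0 -linearB => /eqP/f0/eqP.
by rewrite subr_eq0 => /eqP.
Qed.

Lemma linear_bij_inv M N (f : {linear M -> N}) : bijective f ->
  exists g : {linear N -> M}, cancel f g /\ cancel g f.
Proof.
move=> [g fK gK]; have [|g' g'E] := @linear_mk _ _ g; last first.
  by exists g'; split=> x; rewrite g'E.
by move=> a x y; apply: (can_inj fK); rewrite linearP !gK.
Qed.

Lemma surj_factor N P X (g : {linear N -> P}) (u : {linear N -> X}) :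
  (forall z, exists y, g y = z) -> (forall y, g y = 0 -> u y = 0) ->
  exists w : {linear P -> X}, forall y, w (g y) = u y.
Proof.
move=> /choice[s gs] u0; have uE y y' : g y = g y' -> u y = u y'.
  move=> e; apply/eqP; rewrite -subr_eq0 -linearB u0 //.
  by rewrite linearB e subrr.
have [|w wE] := @linear_mk P X (u \o s); last first.
  by exists w => y; rewrite wE; apply: uE.
by move=> a x y /=; rewrite -linearP; apply: uE; rewrite linearP !gs.
Qed.

Lemma inj_factor M N X (f : {linear M -> N}) (u : {linear X -> N}) :
  injective f -> (forall x, exists y, f y = u x) ->
  exists w : {linear X -> M}, forall x, f (w x) = u x.
Proof.
move=> inj_f /choice[w0 w0E]; have [|w wE] := @linear_mk X M w0; last first.
  by exists w => x; rewrite wE.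
by move=> a x y; apply: inj_f; rewrite linearP !w0E linearP.
Qed.

(** Universal property of a presentation. The chosen coordinates are not linear in v, but the
    hypothesis on relations makes the resulting combination of the y j independent of the choice. *)
Lemma fin_gen_lift F X n (e : 'I_n -> F) (y : 'I_n -> X) :
  (forall v, exists c : 'I_n -> R, v = \sum_j c j *: e j) ->
  (forall c : 'I_n -> R, \sum_j c j *: e j = 0 -> \sum_j c j *: y j = 0) ->
  exists g : {linear F -> X}, forall j, g (e j) = y j.
Proof.
move=> /choice[c cE] rel.
have gE v (d : 'I_n -> R) : v = \sum_j d j *: e j ->
    \sum_j c v j *: y j = \sum_j d j *: y j.
  move=> vE; apply/eqP; rewrite -subr_eq0 -sumrB; apply/eqP.
  rewrite -[RHS](rel (fun j => c v j - d j)).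
    by apply: eq_bigr => j _; rewrite scalerBl.
  rewrite (eq_bigr _ (fun j _ => scalerBl _ _ _)) sumrB -cE -vE.
  exact: subrr.
have [|g g_def] := @linear_mk F X (fun v => \sum_j c v j *: y j).
  move=> a u v; rewrite (gE _ (fun j => a * c u j + c v j)).
    rewrite scaler_sumr -big_split; apply: eq_bigr => j _ /=.
    by rewrite scalerDl scalerA.
  rewrite {1}(cE u) {1}(cE v) scaler_sumr -big_split.
  by apply: eq_bigr => j _ /=; rewrite scalerDl scalerA.
exists g => i; rewrite g_def (gE _ (fun j => (j == i)%:R)).
  rewrite (bigD1 i) //= eqxx scale1r big1 ?addr0 // => j /negPf->.
  by rewrite scale0r.
rewrite (bigD1 i) //= eqxx scale1r big1 ?addr0 // => j /negPf->.
by rewrite scale0r.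
Qed.

Lemma fin_gen_surj M N (f : {linear M -> N}) :
  (forall y, exists x, f x = y) -> fin_gen M -> fin_gen N.
Proof.
move=> fS [n [e eP]]; exists n, (f \o e) => y.
have [x <-] := fS y; have [c ->] := eP x; exists c.
by rewrite linear_sum; apply: eq_bigr => i _; rewrite linearZ.
Qed.

Lemma schur M N (f : {linear M -> N}) : irreducible M -> irreducible N ->
  (exists x, f x <> 0) -> isom M N.
Proof.
move=> irrM irrN [x fx0]; exists f; apply: inj_surj_bij.
  have [||f0] := irrM.2 [set y | f y = 0].
  - by split=> [|a u v /= u0 v0]; rewrite /= ?linear0// linearP u0 v0 scaler0 addr0.
  - exact: linear_inj0.
  - by case: fx0; exact: f0.
have [||fT] // := irrN.2 (range f).
- split=> [|a _ _ [u _ <-] [v _ <-]]; first by exists 0; rewrite ?linear0.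
  by exists (a *: u + v); rewrite ?linearP.
- by move=> f0; case: fx0; apply: f0; exists x.
- by move=> y; have [z _ <-] := fT y; exists z.
Qed.

Definition has_section M N (p : {linear M -> N}) : Prop :=
  exists s : {linear N -> M}, forall y, p (s y) = y.

(** The section is the sum of the [g k \o q k]. The L k may be arbitrary modules, as is required for
    the members of F(h). *)
Lemma direct_sum_lift n (L : 'I_n -> lmodType R) M N (p : {linear M -> N})
    (i : forall k, {linear L k -> N}) (q : forall k, {linear N -> L k}) :
  (forall v, \sum_k i k (q k v) = v) ->
  (forall k, exists g : {linear L k -> M}, forall v, p (g v) = i k v) ->
  has_section p.
Proof.
move=> iq lifts; pose g k := sval (cid (lifts k)).
have gE k v : p (g k v) = i k v by exact: (svalP (cid (lifts k))).
have [|s sE] := @linear_mk N M (fun v => \sum_k g k (q k v)).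
  move=> a u v; rewrite scaler_sumr -big_split; apply: eq_bigr => k _ /=.
  by rewrite !linearP.
exists s => v; rewrite sE linear_sum -[RHS]iq.
by apply: eq_bigr => k _; exact: gE.
Qed.

End LinearMaps.

Section Presentation.
Local Open Scope classical_set_scope.
Variables (K : idomainType) (H : algType K).
Implicit Types F X Y : lmodType H^c.

(** The kernel of the map from H^n to X given by x, treated as a module over K because the
    Noetherian hypothesis concerns K. *)
Definition relations n X (x : 'I_n -> X) : set {ffun 'I_n -> H} :=
  [set c | \sum_j (c j : H^c) *: x j = 0].

Lemma relations_submodule n X (x : 'I_n -> X) : submodule (relations x).
Proof.
have [rl rr] := @ract_bilinear K H X.
split=> [|a u v u0 v0]; rewrite /relations /=.
  by apply: big1 => j _; rewrite ffunE; exact: (@scale0r H^c X).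
transitivity (a *: (\sum_j (u j : H^c) *: x j : resK X)
              + (\sum_j (v j : H^c) *: x j : resK X)); last first.
  by rewrite u0 v0 scaler0 addr0.
rewrite scaler_sumr -big_split; apply: eq_bigr => j _.
by rewrite !ffunE; exact: (rl (x j) a (u j) (v j)).
Qed.

(** Once finitely many obstructions are killed in Y, this extends the conclusion to their whole
    K-span. *)
Lemma relation_values_submodule n r X Y (i : {linear X -> Y})
    (rho : 'I_r -> {ffun 'I_n -> H}) :
  submodule [set psi : {ffun 'I_r -> resK X} | exists y : 'I_n -> Y,
    forall l, \sum_j (rho l j : H^c) *: y j = i (psi l)].
Proof.
have [rl rr] := @ract_bilinear K H Y.
split=> [|a u v [y yE] [z zE]]; rewrite /=.
  exists (fun=> 0) => l; rewrite ffunE [RHS]linear0.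
  by apply: big1 => j _; rewrite scaler0.
exists (fun j => a *: (y j : resK Y) + (z j : resK Y)) => l.
rewrite !ffunE linearD [i (_ *: _)]linearZ_LR -yE -zE.
transitivity (a *: (\sum_j (rho l j : H^c) *: y j : resK Y)
              + (\sum_j (rho l j : H^c) *: z j : resK Y)); last by [].
rewrite scaler_sumr -big_split; apply: eq_bigr => j _.
exact: (rr (rho l j) a (y j) (z j)).
Qed.

End Presentation.

(** * Heights *)

Section Heights.
Local Open Scope classical_set_scope.
Variables (K : idomainType) (H : algType K).
Local Notation HK := (loc_alg H).
Variable ht : lmodType HK^c -> int.
Hypothesis htP : height_function ht.
Implicit Types (M N : lmodType H^c) (V L : lmodType HK^c).

Lemma to_loc_eq0 M (m : M) : torsion_free (resK M) -> to_loc m = 0 -> m = 0.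
Proof.
move=> tfM /lfracP[r r0]; rewrite /= !scaler0 (scale1r (m : resK M)).
by move=> /tfM[/eqP|//]; rewrite (negPf r0).
Qed.

Lemma height_le_eq0 k V :
  (forall L (f : {linear L -> V}), irreducible L -> ht L <= k ->
     forall x, f x = 0) ->
  forall v, height_le ht k V v -> v = 0.
Proof.
move=> V0 v; apply: (submod_span_min (U := [set x | x = 0])).
  by split=> // a x y -> ->; rewrite scaler0 addr0.
by move=> w [_ [L [f [irrL Lk _ ->]]] [x _ <-]]; exact: V0.
Qed.

Lemma filt_nonpos M k m : torsion_free (resK M) -> k <= 0 -> filt ht k M m -> m = 0.
Proof.
move=> tfM k0 /height_le_eq0 m0; apply: to_loc_eq0 => //; apply: m0.
by move=> L f irrL Lk; have := htP.2 L irrL; lia.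
Qed.

Definition pure (i : int) V : Prop := exists n (L : 'I_n -> lmodType HK^c),
  (forall k, irreducible (L k) /\ ht (L k) = i) /\ direct_sum L V.

Lemma pure_filtT i M m : pure i (locM M) -> filt ht i M m.
Proof.
move=> [n [L [irrL [f [p [pf pf0 fp]]]]]]; rewrite /= /filt_set /= -(fp (to_loc m)).
rewrite (eq_bigr _ (fun k _ => esym (scale1r _))).
apply: submodule_sum => [|k]; first exact: sum_submodP.
apply: (mem_submod_span
  (T := \bigcup_(U in irr_submod (fun L => ht L <= i) (locM M)) U)).
exists (range (f k)); last by exists (p k (to_loc m)).
exists (L k), (f k); have [irr_k ht_k] := irrL k.
by split=> //; [rewrite ht_k|exact: can_inj (pf k)].
Qed.

(** By Schur, a nonzero map from an irreducible of height at most k to a summand of height i would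
    be an isomorphism, and heights are invariant under isomorphism. *)
Lemma pure_filt_eq0 i k M m : torsion_free (resK M) -> pure i (locM M) -> k < i ->
  filt ht k M m -> m = 0.
Proof.
move=> tfM [n [L [irrL [f [p [pf pf0 fp]]]]]] ki.
move/height_le_eq0 => m0; apply: to_loc_eq0 => //; apply: m0 => L' g irrL' L'k x.
rewrite -(fp (g x)) big1 // => j _; have [irr_j ht_j] := irrL j.
apply: contrapT => /eqP gx; have gx0 : (p j \o g) x <> 0.
  by move=> /= e; move: gx; rewrite e linear0 eqxx.
have := htP.1 _ _ irrL' irr_j (schur irrL' irr_j (ex_intro _ x gx0)); lia.
Qed.

(* Every irreducible module is a quotient of [H_K], hence isomorphic to one of
   the finitely many irreducible submodules of [H_K] needed to write 1. *)
Lemma height_bounded : semisimple (HK^c)^o ->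
  exists b : int, forall L, irreducible L -> ht L <= b.
Proof.
(* W consists of the x for which the irreducibles not annihilated by x have bounded height. It is a
   submodule, and it contains each irreducible submodule L because [z |-> f z *: v] compares L with
   L'. *)
move=> ssH; pose W := [set x : (HK^c)^o | exists b : int,
  forall L (v : L), irreducible L -> (x : HK^c) *: v <> 0 -> ht L <= b].
suff [b bP] : W 1.
  exists b => L irrL; have [v v0] := irrL.1; apply: (bP L v) => //.
  by rewrite scale1r.
have : sum_submod (irr_submod (fun=> True) (HK^c)^o) 1 by rewrite ssH.
apply: (submod_span_min (U := W)).
  split=> [|a x y [b bP] [c cP]]; first by exists 0 => L v _; rewrite scale0r.
  exists (Num.max b c) => L v irrL.
  have [xv0|xv] := eqVneq ((x : HK^c) *: v) 0; last first.
    by move=> _; rewrite le_max (bP L v) //; exact/eqP.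
  have [yv0|yv] := eqVneq ((y : HK^c) *: v) 0; last first.
    by move=> _; rewrite le_max (cP L v) ?orbT //; exact/eqP.
  by case; rewrite scalerDl -scalerA xv0 yv0 scaler0 addr0.
move=> w [_ [L [f [irrL _ _ ->]]] [x _ <-]]; exists (ht L) => L' v irrL' fxv.
have [|g gE] := @linear_mk _ L L' (fun z => (f z : HK^c) *: v).
  by move=> a y z; rewrite linearP scalerDl scalerA.
suff iLL' : isom L L' by rewrite (htP.1 _ _ irrL irrL' iLL').
by apply: (schur irrL irrL' (f := g)); exists x; rewrite gE.
Qed.

Lemma pure_gt_bound b i M m : (forall L, irreducible L -> ht L <= b) -> b < i ->
  torsion_free (resK M) -> pure i (locM M) -> m = 0 :> M.
Proof.
move=> bP bi tfM [n [L [irrL [f [p [_ _ fp]]]]]].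
apply: to_loc_eq0 => //; rewrite -(fp (to_loc m)) big1 // => k _.
by have [/bP + ht_k] := irrL k; lia.
Qed.

End Heights.

(** * Exact categories of modules *)

Section ExactCategory.
Variables (R : pzRingType) (A : lmodType R -> Prop) (E : sequences R).
Hypothesis exA : exact_category A E.
Hypothesis exE : forall (M N P : lmodType R)
    (f : {linear M -> N}) (g : {linear N -> P}),
  E f g -> short_exact f g.
Implicit Types L M N P Q X Y Z : lmodType R.

Lemma short_exact_comp0 M N P (f : {linear M -> N}) (g : {linear N -> P}) :
  short_exact f g -> forall x, g (f x) = 0.
Proof. by move=> [_ gf _] x; apply/gf; exists x. Qed.

(** An inflation determines its cokernel up to isomorphism, so the sequence in E starting with f can
    be transported to g. Membership in E is thereby reduced to exactness of modules. *)
Lemma inflation_short_exact M N P (f : {linear M -> N}) (g : {linear N -> P}) :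
  inflation E f -> short_exact f g -> A P -> E f g.
Proof.
move=> [P' [g' Efg']] fg AP; have fg' := exE Efg'.
have [AM AN _] := ec_obj exA Efg'.
have [_ g0 g_onto] := fg; have [_ g'0 g'_onto] := fg'.
have [y|c cE] := surj_factor (u := g) g'_onto.
  by move/g'0 => [x <-]; exact: short_exact_comp0 fg x.
have c_bij : bijective c.
  apply: inj_surj_bij => [|z]; last first.
    by have [y <-] := g_onto z; exists (g' y).
  apply: linear_inj0 => z; have [y <-] := g'_onto z.
  by rewrite cE => /g0[x <-]; exact: short_exact_comp0 fg' x.
by apply: (ec_iso exA (a := idfun) (b := idfun) (c := c) Efg') => //; exists id.
Qed.

Lemma deflation_short_exact M N P (f : {linear M -> N}) (g : {linear N -> P}) :
  deflation E g -> short_exact f g -> A M -> E f g.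
Proof.
move=> [M' [f' Ef'g]] fg AM; have f'g := exE Ef'g.
have [AM' AN AP] := ec_obj exA Ef'g.
have [f_inj f0 _] := fg; have [f'_inj f'0 _] := f'g.
have [x|a aE] := inj_factor (u := f') f_inj.
  by apply/f0; exact: short_exact_comp0 f'g x.
have a_bij : bijective a.
  apply: inj_surj_bij => [x y axy|x].
    by apply: f'_inj; rewrite -!aE axy.
  have /f'0[y yx] := short_exact_comp0 fg x.
  by exists y; apply: f_inj; rewrite aE.
by apply: (ec_iso exA (a := a) (b := idfun) (c := idfun) Ef'g) => //; exists id.
Qed.

Lemma inflation_id M : A M -> inflation E (idfun : {linear M -> M}).
Proof.
move=> AM; have [[Z [AZ Z0]] _] := ec_additive exA.
exists Z, \0; apply: (ec_split exA (p1 := idfun) (i2 := \0)) => //.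
by split=> // y; rewrite /= ?addr0// [RHS]Z0.
Qed.

(** The pushout is universal only against objects of A, so it is not known to be the pushout of
    modules; its cokernel is identified with Q through the universal property, g' being induced by g
    and 0. *)
Lemma pushout_cokernel X N Q Y (f : {linear X -> N}) (g : {linear N -> Q})
    (h : {linear X -> Y}) : E f g -> A Y ->
  exists Y' (f' : {linear Y -> Y'}) (g' : {linear Y' -> Q}) (h' : {linear N -> Y'}),
    [/\ E f' g', forall x, h' (f x) = f' (h x), forall y, g' (h' y) = g y &
      forall (Z : lmodType R) (u v : {linear Y' -> Z}), A Z ->
        (forall y, u (h' y) = v (h' y)) ->
        (forall y, u (f' y) = v (f' y)) -> u =1 v].
Proof.
move=> Efg AY; have [AX AN AQ] := ec_obj exA Efg; have fg := exE Efg.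
have inf_f : inflation E f by exists Q, g.
have [Y' [h' [f' [AY' [comm univ] inf_f']]]] := ec_pushout exA h inf_f AY.
have uniq (Z : lmodType R) (u v : {linear Y' -> Z}) : A Z ->
    (forall y, u (h' y) = v (h' y)) ->
    (forall y, u (f' y) = v (f' y)) -> u =1 v.
  move=> AZ uvh uvf.
  have [x|w [_ w_uniq]] := univ _ (u \o h') (u \o f') AZ; first by rewrite /= comm.
  by move=> y; rewrite w_uniq // [RHS]w_uniq // => z; rewrite /= ?uvh ?uvf.
have [x|g' [[g'h' g'f'] _]] := univ _ g \0 AQ; first exact: short_exact_comp0 fg x.
exists Y', f', g', h'; split=> //.
have [P [c Efc]] := inf_f'; have [_ _ AP] := ec_obj exA Efc.
have [f'_inj c0 c_onto] := exE Efc; have [_ g0 g_onto] := fg.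
(* The cokernel c of f' factors as d \o g', which bounds the kernel of g' by the image of f'. *)
have [y|d dE] := surj_factor (u := c \o h') g_onto.
  by move/g0 => [x <-] /=; rewrite comm; apply/c0; exists (h x).
have dg' : d \o g' =1 c.
  apply: uniq => // y /=; first by rewrite g'h' dE.
  by rewrite g'f' linear0; apply/esym/c0; exists y.
apply: inflation_short_exact => //; split=> // [y|z].
  split=> [g'y|[x <-]]; last exact: g'f'.
  by apply/c0; rewrite -dg' /= g'y linear0.
by have [y <-] := g_onto z; exists (h' y).
Qed.

(** Dual argument: f' is induced by f and 0, and the kernel k of g' factors through it. *)
Lemma pullback_kernel X N Q P (f : {linear X -> N}) (g : {linear N -> Q})
    (h : {linear P -> Q}) : E f g -> A P ->
  exists N' (f' : {linear X -> N'}) (g' : {linear N' -> P}) (h' : {linear N' -> N}),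
    [/\ E f' g', forall x, h' (f' x) = f x & forall y, g (h' y) = h (g' y)].
Proof.
move=> Efg AP; have [AX AN AQ] := ec_obj exA Efg; have fg := exE Efg.
have def_g : deflation E g by exists X, f.
have [N' [h' [g' [AN' [comm univ] def_g']]]] := ec_pullback exA h def_g AP.
have [x|f' [[h'f' g'f'] _]] := univ _ f \0 AX.
  by rewrite linear0; exact: short_exact_comp0 fg x.
exists N', f', g', h'; split=> //.
have [L [k Ekg]] := def_g'; have [AL _ _] := ec_obj exA Ekg.
have [_ k0 g'_onto] := exE Ekg; have [f_inj f0 _] := fg.
have [x|d dE] := inj_factor (u := h' \o k) f_inj.
  by apply/f0; rewrite /= comm (_ : g' (k x) = 0) ?linear0//; apply/k0; exists x.
have f'd : f' \o d =1 k.
  have [x|w [_ w_uniq]] := univ _ (h' \o k) (g' \o k) AL; first exact: comm.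
  move=> x; transitivity (w x); last exact/esym/w_uniq.
  apply: w_uniq => {}x /=; first by rewrite h'f' dE.
  by rewrite g'f'; apply/esym/k0; exists x.
apply: deflation_short_exact => //; split=> // [x y xy|y].
  by apply: f_inj; rewrite -!h'f' xy.
split=> [/k0[x <-]|[x <-]]; last exact: g'f'.
by exists (d x); exact: f'd.
Qed.

(* The extension [Z / X] of N by [Q = Y / X] splits; take for Z0 the preimage in Z
   of a complement of Q. *)
Lemma extension_restrict X Y Q N Z (i : {linear X -> Y}) (q : {linear Y -> Q})
    (j : {linear Y -> Z}) (p : {linear Z -> N}) : E i q -> E j p ->
  (forall (Z' : lmodType R) (j' : {linear Q -> Z'}) (p' : {linear Z' -> N}),
     E j' p' -> has_section p') ->
  exists Z0 (j0 : {linear X -> Z0}) (p0 : {linear Z0 -> N}) (phi : {linear Z0 -> Z}),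
    [/\ E j0 p0, forall x, phi (j0 x) = j (i x) & forall z, p (phi z) = p0 z].
Proof.
move=> Eiq Ejp splitQ; have [_ AY AQ] := ec_obj exA Eiq.
have [_ AZ AN] := ec_obj exA Ejp.
(* Pushing out along q realizes Z / X as an object Z' of A; [Ejih] below confirms that X is the
   kernel of h. *)
have [Z' [j' [p' [h [Ej'p' hj p'h uniq]]]]] := pushout_cokernel q Ejp AQ.
have [_ AZ' _] := ec_obj exA Ej'p'.
have [s sE] := splitQ _ _ _ Ej'p'.
have Ejih : E (j \o i) h.
  have [_ q0 q_onto] := exE Eiq; have [j_inj p0 p_onto] := exE Ejp.
  have [j'_inj p'0 _] := exE Ej'p'; have [i_inj _ _] := exE Eiq.
  apply: inflation_short_exact => //.
    by apply: (ec_inflation_comp exA); [exists Q, q|exists N, p].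
  split=> [||z].
  - exact: inj_comp.
  - move=> z; split=> [hz|[x <-] /=]; last first.
      by rewrite hj (_ : q (i x) = 0) ?linear0//; apply/q0; exists x.
    have /p0[y yz] : p z = 0 by rewrite -p'h hz linear0.
    have /q0[x xy] : q y = 0 by apply: j'_inj; rewrite -hj yz hz linear0.
    by exists x; rewrite /= xy.
  - have [y yz] := p_onto (p' z).
    have /p'0[x xE] : p' (z - h y) = 0 by rewrite linearB p'h yz subrr.
    have [w wx] := q_onto x; exists (y + j w).
    by rewrite linearD hj wx xE addrC subrK.
have [Z0 [j0 [p0 [phi [Ej0p0 phij0 hphi]]]]] := pullback_kernel s Ejih AN.
by exists Z0, j0, p0, phi; split=> // z; rewrite -p'h hphi sE.
Qed.

End ExactCategory.

(** * Split extensions and the vanishing of Ext^1 *)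

Section SplitExtensions.
Variable R : pzRingType.
Implicit Types Y Z : lmodType R.

Lemma ext_equiv_sym Y Z (e e' : extension Y Z) : ext_equiv e e' -> ext_equiv e' e.
Proof.
move=> [phi [/linear_bij_inv[psi [phiK psiK]] phi_i phi_p]].
exists psi; split=> [|z|x]; first by exists phi.
  by rewrite -phi_i phiK.
by rewrite -phi_p psiK.
Qed.

Lemma ext_equiv_trans Y Z (e1 e2 e3 : extension Y Z) :
  ext_equiv e1 e2 -> ext_equiv e2 e3 -> ext_equiv e1 e3.
Proof.
move=> [phi [phi_bij phi_i phi_p]] [psi [psi_bij psi_i psi_p]].
exists (psi \o phi); split=> [|z|x] /=; first exact: bij_comp.
  by rewrite phi_i.
by rewrite psi_p.
Qed.

Lemma ext_class_eq (E : sequences R) Y Z (e e' : extension Y Z) :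
  ext_equiv e e' -> ext_class E e = ext_class E e'.
Proof.
move=> ee'; apply/funext => e0; apply/propext; split=> -[Ee0 e0_eq]; split=> //.
  exact: ext_equiv_trans (ext_equiv_sym ee') e0_eq.
exact: ext_equiv_trans ee' e0_eq.
Qed.

Lemma section_ext_equiv Y Z (e : extension Y Z) :
  short_exact (ext_inc e) (ext_proj e) -> has_section (ext_proj e) ->
  ext_equiv e (split_extension Y Z).
Proof.
case: e => M i p /= ip [s sE]; have [i_inj p0 _] := ip.
(* u projects M onto the image of i along that of s; factored through i it becomes a retraction w,
   and the equivalence is (w, p). *)
have [|u uE] := @linear_mk _ M M (fun m => m - s (p m)).
  by move=> a x y; rewrite !linearP /= scalerDr addrACA.
have [x|w wE] := inj_factor (u := u) i_inj.
  by apply/p0; rewrite uE linearB /= sE subrr.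
have [|phi phiE] := @linear_mk _ M (Z * Y)%type (fun m => (w m, p m)).
  by move=> a x y; rewrite !linearP.
exists phi => /=; split=> [|z|x]; last by rewrite phiE.
  exists (fun zy => i zy.1 + s zy.2) => [m|[z y]].
    by rewrite phiE /= wE uE subrK.
  rewrite phiE /= (linearD p) sE (_ : p (i z) = 0) ?add0r; last first.
    by apply/p0; exists z.
  congr (_, _); apply: i_inj; rewrite wE uE (linearD p) sE.
  by rewrite (_ : p (i z) = 0) ?add0r ?addrK //; apply/p0; exists z.
have piz : p (i z) = 0 by apply/p0; exists z.
rewrite phiE piz; congr (_, _); apply: i_inj.
by rewrite wE uE piz linear0 subr0.
Qed.

Variables (A : lmodType R -> Prop) (E : sequences R).
Hypothesis exA : exact_category A E.
Hypothesis exE : forall (M N P : lmodType R)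
    (f : {linear M -> N}) (g : {linear N -> P}),
  E f g -> short_exact f g.

Lemma Ext1_eq0_section Y Z : A Y -> A Z ->
  (forall (M : lmodType R) (i : {linear Z -> M}) (p : {linear M -> Y}),
     E i p -> has_section p) ->
  Ext1_eq0 E Y Z.
Proof.
move=> AY AZ splitE C.
have eq_split (e : extension Y Z) :
    ext_in E e -> ext_class E e = ext_class E (split_extension Y Z).
  by move=> Ee; apply/ext_class_eq/section_ext_equiv; [exact: exE|exact: splitE Ee].
split=> [[e Ee ->]|->]; first exact: eq_split.
(* The product Z * Y is not known to lie in A, so a representative in E of the split class comes
   from a biproduct in A. *)
have [_ /(_ Z Y AZ AY)[N [AN [i1 [p1 [i2 [p2 bi]]]]]]] := ec_additive exA.
have Ee : ext_in E (Extension i1 p2) by exact: (ec_split exA AZ AY AN bi).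
by exists (Extension i1 p2) => //; rewrite eq_split.
Qed.
End SplitExtensions.

(** * Enlarging an object stratum by stratum *)

Section Strata.
Local Open Scope classical_set_scope.
Variables (K : idomainType) (H : algType K).
Local Notation HK := (loc_alg H).
Hypothesis noethK : noetherian K.
Hypothesis finH : fin_gen (H : lmodType K).
Variable ht : lmodType HK^c -> int.
Hypothesis htP : height_function ht.
Variable S : int -> lmodType H^c -> Prop.
Hypothesis SP : strata ht S.
Variables (A : lmodType H^c -> Prop) (E : sequences H^c).
Hypothesis subAE : full_exact_subcategory A E (AS ht S) (ES ht S).
Hypothesis E_filt : forall (M N P : lmodType H^c)
    (f : {linear M -> N}) (g : {linear N -> P}),
  A M -> A N -> A P -> E f g ->
  forall h : int, E (@Fil_map K H ht h M N f) (@Fil_map K H ht h N P g).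
Implicit Types F M N P Q X Y Z : lmodType H^c.

Lemma sub_exact : exact_category A E. Proof. by case: subAE. Qed.
Let exA := sub_exact.

Lemma sub_ES M N P (f : {linear M -> N}) (g : {linear N -> P}) :
  E f g -> ES ht S f g.
Proof. by case: subAE => _ _; apply. Qed.

Lemma sub_short_exact M N P (f : {linear M -> N}) (g : {linear N -> P}) :
  E f g -> short_exact f g.
Proof. by case/sub_ES. Qed.
Let exE := sub_short_exact.

Lemma S_torsion_free i N : S i N -> torsion_free (resK N).
Proof. by have [_ _ /[apply] -[]] := SP i. Qed.

Lemma S_pure i N : S i N -> pure ht i (locM N).
Proof. by have [_ _ /[apply] -[]] := SP i. Qed.

Lemma S_filt_eq0 i k N n : S i N -> k < i -> filt ht k N n -> n = 0.
Proof. by move=> SN; apply: (pure_filt_eq0 htP (S_torsion_free SN) (S_pure SN)). Qed.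

(** Strictness of the filtration along sequences in E, read off from hypothesis (4). *)
Lemma filt_exact k M N P (f : {linear M -> N}) (g : {linear N -> P}) y :
  E f g -> filt ht k N y -> g y = 0 -> exists2 x, filt ht k M x & f x = y.
Proof.
move=> Efg ky gy; have [AM AN AP] := ec_obj exA Efg.
have [_ g0 _] := exE (E_filt AM AN AP Efg k).
have /submod_predP ky' := ky.
have [|x xy] := (g0 (Subm ky')).1; first by apply: val_inj; rewrite /= gy.
exists (subm_val x); first exact/submod_predP/subm_valP.
by rewrite -[RHS]/(subm_val (Subm ky')) -xy.
Qed.

(** The vanishing of Ext^1 of N by X without equivalence classes; the passage to classes is made
    only at the end. *)
Definition splits N X : Prop :=
  forall M (i : {linear X -> M}) (p : {linear M -> N}), E i p -> has_section p.

Lemma splits_low a N X : S a N -> (forall x, filt ht (a - 1) X x -> x = 0) ->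
  splits N X.
Proof.
move=> SN X0 M i p Eip.
have N0 n : filt ht (a - 1) N n -> n = 0 by apply: (S_filt_eq0 SN); lia.
have M0 m : filt ht (a - 1) M m -> m = 0.
  move=> am; have pm : p m = 0 by apply: N0; exact: filt_stable am.
  by have [x /X0-> <-] := filt_exact Eip am pm; rewrite linear0.
have [_ _ _ _ /(_ a)[_ [s sE]]] := sub_ES Eip.
have NT n : n \in submod_pred (filt ht a N).
  by apply/submod_predP; exact: pure_filtT (S_pure SN).
have [|u uE] := @linear_mk _ N (Gr ht a N) (fun n => Gr_proj (Subm (NT n))).
  move=> c x y; rewrite -linearP; congr (Gr_proj _); exact: val_inj.
(* Since M^{a-1} = 0, the a-th layer of M is M^a itself, so the splitting s of the a-th layer can be
   lifted into M. *)
have proj_inj : injective (@Gr_proj K H ht a M).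
  apply: linear_inj0 => x /(quotm_piP (Defs.prev ht a M) x 0).1.
  by rewrite subr0 => /M0 x0; exact: val_inj.
have [n|t tE] := inj_factor (u := s \o u) proj_inj.
  by exists (repr (s (u n))); exact: quotm_reprK.
have [|v vE] := @linear_mk _ N M (fun n => subm_val (t n)).
  by move=> c x y; rewrite linearP.
(* p (v n) and n have the same class in the a-th layer of N, so they differ by an element of N^{a-1}
   = 0. *)
exists v => n; rewrite vE; apply/eqP; rewrite -subr_eq0; apply/eqP/N0.
suff /quotm_piP : Gr_proj (Fil_map p (t n)) = Gr_proj (Subm (NT n)) by [].
by rewrite -Gr_mapE tE /= sE uE.
Qed.

Lemma splits_S a h N Q : a <= h -> S a N -> S h Q -> splits N Q.
Proof.
by move=> ah SN SQ; apply: (splits_low SN) => x; apply: (S_filt_eq0 SQ); lia.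
Qed.

(** The properties of an iterated enlargement by objects of S_h, in a form stable under composition
    and under lowering h. The second clause is surjectivity of Ext^1(N, X) -> Ext^1(N, Y) for N in
    S_a with a <= h. *)
Definition admissible (h : int) X Y (i : {linear X -> Y}) : Prop :=
  [/\ inflation E i,
      forall a N, a <= h -> S a N ->
        forall M (j : {linear Y -> M}) (p : {linear M -> N}), E j p ->
        exists M0 (j0 : {linear X -> M0}) (p0 : {linear M0 -> N})
            (phi : {linear M0 -> M}),
          [/\ E j0 p0, forall x, phi (j0 x) = j (i x) & forall z, p (phi z) = p0 z] &
      forall k, k < h -> bijective (@Fil_map K H ht k X Y i)].

Lemma admissible_A h X Y (i : {linear X -> Y}) : admissible h i -> A Y.
Proof. by move=> [[Q [q /(ec_obj exA)[]]]]. Qed.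

Lemma admissible_id h X : A X -> admissible h (idfun : {linear X -> X}).
Proof.
move=> AX; split; first exact (inflation_id exA AX).
  by move=> a N _ _ M j p Ejp; exists M, j, p, idfun.
by move=> k _; exists id => x; exact: val_inj.
Qed.

Lemma admissible_comp h X Y Z (i : {linear X -> Y}) (j : {linear Y -> Z}) :
  admissible h i -> admissible h j -> admissible h (j \o i).
Proof.
move=> [inf_i lift_i bij_i] [inf_j lift_j bij_j]; split.
- exact: (ec_inflation_comp exA).
- move=> a N ah SN M m p Emp.
  have [M1 [m1 [p1 [phi1 [E1 m1E p1E]]]]] := lift_j a N ah SN M m p Emp.
  have [M0 [m0 [p0 [phi0 [E0 m0E p0E]]]]] := lift_i a N ah SN M1 m1 p1 E1.
  exists M0, m0, p0, (phi1 \o phi0); split=> // x /=; first by rewrite m0E m1E.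
  by rewrite p1E.
move=> k kh; apply: (eq_bij (bij_comp (bij_j k kh) (bij_i k kh))) => x.
exact: val_inj.
Qed.

Lemma admissible_le h h' X Y (i : {linear X -> Y}) :
  h' <= h -> admissible h i -> admissible h' i.
Proof.
move=> h'h [inf_i lift_i bij_i]; split=> // [a N ah'|k kh'].
  by apply: lift_i; exact: le_trans h'h.
by apply: bij_i; exact: lt_le_trans h'h.
Qed.

(** Extensions of N by Q split by [splits_S], so extensions by Y restrict to X; and Q^k = 0 for k <
    h forces Y^k into X. *)
Lemma admissible_cokernel h X Y Q (i : {linear X -> Y}) (q : {linear Y -> Q}) :
  E i q -> S h Q -> admissible h i.
Proof.
move=> Eiq SQ; split=> [|a N ah SN M j p Ejp|k kh]; first by exists Q, q.
  apply: (extension_restrict exA exE Eiq Ejp) => Z j' p'.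
  exact: (splits_S ah SN SQ).
have [AX AY AQ] := ec_obj exA Eiq.
have [k_inj k0 _] := exE (E_filt AX AY AQ Eiq k).
apply: inj_surj_bij => // y; apply/k0; apply: val_inj.
exact: S_filt_eq0 SQ kh (elimT (submod_predP _ _) (subm_valP (Fil_map q y))).
Qed.

Lemma splits_admissible a h X Y N (i : {linear X -> Y}) :
  a <= h -> S a N -> admissible h i -> splits N X -> splits N Y.
Proof.
move=> ah SN [_ lift_i _] splX M j p Ejp.
have [M0 [j0 [p0 [phi [E0 _ p0E]]]]] := lift_i a N ah SN M j p Ejp.
have [s sE] := splX _ _ _ E0; exists (phi \o s) => y /=.
by rewrite p0E sE.
Qed.

(** Replaces the vanishing of Ext^1(F, X): F need not lie in A, so an extension cannot be pulled
    back along f within the exact category. *)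
Definition lifts h F X : Prop :=
  forall N M (i : {linear X -> M}) (p : {linear M -> N}), S h N -> E i p ->
  forall f : {linear F -> N}, exists g : {linear F -> M}, forall v, p (g v) = f v.

Lemma lifts_admissible h F X Y (i : {linear X -> Y}) :
  admissible h i -> lifts h F X -> lifts h F Y.
Proof.
move=> [_ lift_i _] liftX N M j p SN Ejp f.
have [M0 [j0 [p0 [phi [E0 _ p0E]]]]] := lift_i h N (lexx h) SN M j p Ejp.
have [g gE] := liftX _ _ _ _ SN E0 f; exists (phi \o g) => v /=.
by rewrite p0E gE.
Qed.

(** * Obstructions to lifting and their removal *)

Section Obstruction.
Variables (n r : nat) (rho : 'I_r -> {ffun 'I_n -> H}).

(* Given [F = H^n / R] with R generated over [K] by the rho l, an extension M of N
   by X and a map [F -> N], lifted to the generators of F, are recorded by the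
   values in X of the relations rho l at the chosen lifts. *)
Definition obstruction h F (e : 'I_n -> F) X : set {ffun 'I_r -> resK X} :=
  [set psi | exists N M (i : {linear X -> M}) (p : {linear M -> N}),
     [/\ S h N, E i p & exists (f : {linear F -> N}) (m : 'I_n -> M),
        (forall j, p (m j) = f (e j)) /\
        forall l, \sum_j (rho l j : H^c) *: m j = i (psi l)]].

(** A coboundary condition: subtracting the y j from the chosen lifts of the generators makes them
    satisfy the relations rho l. *)
Definition obstruction_killed X Y (i : {linear X -> Y})
    (psi : {ffun 'I_r -> resK X}) : Prop :=
  exists y : 'I_n -> Y, forall l, \sum_j (rho l j : H^c) *: y j = i (psi l).

Lemma kill_obstructions h F (e : 'I_n -> F) X (s : seq {ffun 'I_r -> resK X}) :
  A X ->
  (forall psi, psi \in s -> obstruction h e psi) ->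
  exists Y (i : {linear X -> Y}), admissible h i /\
    forall psi, psi \in s -> obstruction_killed i psi.
Proof.
move=> AX; elim: s => [|psi s IHs] sP.
  by exists X, idfun; split=> //; exact: admissible_id.
have [t ts|Y [i [adm_i ki]]] := IHs; first by apply: sP; rewrite inE ts orbT.
have [N [M [j [p [SN Ejp [_ [m [_ mE]]]]]]]] := sP psi (mem_head _ _).
(* Pushing the extension M out along i yields Z with cokernel N in S_h, where the images [h' (m j)]
   kill psi; obstructions killed earlier stay killed. *)
have [Z [k [q [h' [Ekq hj _ _]]]]] :=
  pushout_cokernel exA exE i Ejp (admissible_A adm_i).
exists Z, (k \o i); split.
  exact: admissible_comp adm_i (admissible_cokernel Ekq SN).
move=> t; rewrite inE => /orP[/eqP->|/ki[y yE]].
  exists (h' \o m) => l; rewrite /= -hj -mE linear_sum.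
  by apply: eq_bigr => v _; rewrite linearZ.
exists (k \o y) => l; rewrite /= -yE linear_sum.
by apply: eq_bigr => v _; rewrite linearZ.
Qed.
End Obstruction.

(** That F is a quotient of an object of S_h provides its finite generation, hence a presentation
    with finitely many relations over K. *)
Lemma lifts_inflation h F X : A X ->
  (exists N (q : {linear N -> F}), S h N /\ forall y, exists x, q x = y) ->
  exists Y (i : {linear X -> Y}), admissible h i /\ lifts h F Y.
Proof.
move=> AX [N0 [q [SN0 q_onto]]].
have [n [e eP]] : fin_gen F.
  apply: (fin_gen_surj q_onto).
  have [_ _ /(_ _ SN0)[[n [e eP]] _ _]] := SP h.
  exists n, e => v; have [c ->] := eP v.
  by exists (fun i => (c i)%:A : H).
have [sH /(submod_span_ffun n)[sHn sHnP]] := fin_gen_submod_span finH.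
have [|R Rrel relR] :=
  noetherian_submodule noethK (relations_submodule e) (e := sHn).
  by move=> c _; exact: sHnP.
pose rho (l : 'I_(size R)) := tnth (in_tuple R) l.
have fgX : fin_gen (resK X) by case: subAE => _ /(_ _ AX)[].
have [sX /(submod_span_ffun (size R))[sXr sXrP]] := fin_gen_submod_span fgX.
(* The obstructions need not be shown to form a submodule: finitely many of them span all the
   others, and the killed functions do form a submodule. *)
have [s sT Ts] := noetherian_subset noethK (obstruction rho h e (X := X)) sXrP.
have [Y [i [adm_i ki]]] := kill_obstructions AX sT.
have kT psi : obstruction rho h e psi -> obstruction_killed rho i psi.
  by move=> /Ts; apply: submod_span_min ki; exact: relation_values_submodule.
exists Y, i; split=> // N M j p SN Ejp f.
have [_ lift_i _] := adm_i.
(* The obstructions killed are those with values in X, so the extension by Y is first restricted to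
   one by X. *)
have [M0 [j0 [p0 [phi [E0 phij0 p0E]]]]] := lift_i h N (lexx h) SN M j p Ejp.
have [_ ker_p0 /choice[t tE]] := exE E0.
pose m k := t (f (e k)).
have /choice[psi psiE] l : exists x, j0 x = \sum_k (rho l k : H^c) *: m k.
  apply/ker_p0; rewrite linear_sum.
  transitivity (f (\sum_k (rho l k : H^c) *: e k)).
    by rewrite linear_sum; apply: eq_bigr => k _; rewrite !linearZ /= tE.
  by rewrite [X in f X](Rrel (rho l)) ?linear0 ?mem_tnth.
have [|y yE] := kT [ffun l => psi l].
  exists N, M0, j0, p0; split=> //; exists f, m.
  by split=> [k|l]; rewrite ?tE// ffunE psiE.
(* The corrected lifts satisfy every relation of F, so they define a map on F, and p does not see
   the correction. *)
pose m' k := phi (m k) - j (y k).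
have [c c0|g gE] := fin_gen_lift (y := m') eP.
  have /relR : relations e (finfun c : {ffun 'I_n -> H}).
    by rewrite /relations /= -[RHS]c0; apply: eq_bigr => k _; rewrite ffunE.
  move/(submod_span_min (relations_submodule m')) => /(_ _)/wrap[].
    move=> _ /(nthP 0)[l lR <-]; pose l' := Ordinal lR.
    rewrite (_ : R`_l = rho l'); last by rewrite /rho (tnth_nth 0).
    rewrite /relations /= /m' (eq_bigr _ (fun k _ => scalerBr _ _ _)) sumrB.
    apply/eqP; rewrite subr_eq0; apply/eqP.
    transitivity (phi (\sum_k (rho l' k : H^c) *: m k)).
      by rewrite linear_sum; apply: eq_bigr => k _; rewrite linearZ.
    rewrite -psiE phij0; transitivity (j (\sum_k (rho l' k : H^c) *: y k)).
      by rewrite yE ffunE.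
    by rewrite linear_sum; apply: eq_bigr => k _; rewrite linearZ.
  rewrite /relations /= => rel0; rewrite -[RHS]rel0.
  by apply: eq_bigr => k _; rewrite ffunE.
exists g => v; have [c ->] := eP v; rewrite !linear_sum; apply: eq_bigr => k _.
rewrite !linearZ /= gE /m' linearB p0E tE (_ : p (j (y k)) = 0) ?subr0 //.
exact: short_exact_comp0 (exE Ejp) _.
Qed.

Definition covered (h : int) : Prop := exists (m : nat) (F : 'I_m -> lmodType H^c),
  forall N, S h N ->
    exists (n : nat) (c : 'I_n -> 'I_m), direct_sum (fun k => F (c k)) N.

Lemma split_stratum h X : covered h -> A X ->
  exists Y (i : {linear X -> Y}), admissible h i /\ forall N, S h N -> splits N Y.
Proof.
move=> [m [F FP]] AX.
(* Every F k that occurs as a summand of an object of S_h is such a quotient, and only these are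
   treated. *)
pose quot k := exists N (q : {linear N -> F k}),
  S h N /\ forall y, exists x, q x = y.
have [Y [i [adm_i liftY]]] : exists Y (i : {linear X -> Y}), admissible h i /\
    forall k, k \in enum 'I_m -> quot k -> lifts h (F k) Y.
  elim: (enum _) => [|k s [Y [i [adm_i liftY]]]].
    by exists X, idfun; split=> //; exact: admissible_id.
  have [/(lifts_inflation (admissible_A adm_i))[Z [j [adm_j liftZ]]]|nquot] :=
    pselect (quot k).
    exists Z, (j \o i); split; first exact: admissible_comp.
    move=> l; rewrite inE => /orP[/eqP-> //|ls] quot_l.
    exact: lifts_admissible adm_j (liftY l ls quot_l).
  exists Y, i; split=> // l; rewrite inE => /orP[/eqP-> //|]; exact: liftY.
exists Y, i; split=> // N SN M j p Ejp.
have [n [c [f [q [qf _ fq]]]]] := FP N SN.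
apply: (direct_sum_lift fq) => k.
apply: (liftY (c k) _ _ _ _ _ _ SN Ejp); first by rewrite mem_enum.
by exists N, (q k); split=> // y; exists (f k y); exact: qf.
Qed.

(** Strata are treated upwards: the stage for h + n is admissible at h + n, so it preserves the
    splittings obtained for lower strata and remains admissible at h. *)
Lemma split_strata h n X : (forall a, covered a) -> A X ->
  (forall a N, a < h -> S a N -> splits N X) ->
  exists Y (i : {linear X -> Y}), admissible h i /\
    forall a N, a < h + n%:Z -> S a N -> splits N Y.
Proof.
move=> cov AX splX; elim: n => [|n [Y [i [adm_i splY]]]].
  by exists X, idfun; rewrite addr0; split=> //; exact: admissible_id.
have [Z [j [adm_j splZ]]] := split_stratum (cov (h + n%:Z)) (admissible_A adm_i).
exists Z, (j \o i); split.
  by apply: admissible_comp adm_i (admissible_le _ adm_j); lia.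
move=> a N ah SN; have [ahn|ahn] := eqVneq a (h + n%:Z).
  by apply: splZ; rewrite -ahn.
by apply: (splits_admissible _ SN adm_j); [lia|apply: (splY a) SN; lia].
Qed.

Lemma splits_gt_bound b a N X :
  (forall L : lmodType HK^c, irreducible L -> ht L <= b) -> b < a ->
  S a N -> splits N X.
Proof.
move=> bP ba SN M i p _; exists \0 => y.
by rewrite linear0 (pure_gt_bound y bP ba (S_torsion_free SN) (S_pure SN)).
Qed.

End Strata.

Theorem theorem2p4p10
    (K : idomainType) (H : algType K)
    (noethK : noetherian K)
    (finH : fin_gen (H : lmodType K))
    (tfH : torsion_free (H : lmodType K))
    (ssHK : semisimple ((loc_alg H)^c)^o)
    (ht : lmodType (loc_alg H)^c -> int)
    (htP : height_function ht)
    (S : int -> lmodType H^c -> Prop)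
    (SP : strata ht S)
    (A : lmodType H^c -> Prop) (E : sequences H^c)
    (subAE : full_exact_subcategory A E (AS ht S) (ES ht S))
    (* (1) *)
    (A_iso : forall M N : lmodType H^c, A M -> AS ht S N -> isom M N -> A N)
    (* (2) *)
    (A_S : forall (i : int) (M : lmodType H^c), S i M -> A M)
    (* (3) *)
    (A_filt : forall (M : lmodType H^c) (h : int), A M ->
       [/\ A (Fil ht h M), A (Fil ht (h - 1) M), A (Gr ht h M) &
           E _ _ _ (@Fil_incl K H ht h M) (@Gr_proj K H ht h M)])
    (* (4) *)
    (E_filt : forall (M N P : lmodType H^c)
         (f : {linear M -> N}) (g : {linear N -> P}),
       A M -> A N -> A P -> E M N P f g ->
       forall h : int, E _ _ _ (@Fil_map K H ht h M N f) (@Fil_map K H ht h N P g))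
    (finS : forall h : int, exists (m : nat) (F : 'I_m -> lmodType H^c),
       forall N : lmodType H^c, S h N ->
         exists (n : nat) (c : 'I_n -> 'I_m), direct_sum (fun k => F (c k)) N)
    (M : lmodType H^c) (AM : A M) :
  exists (X : lmodType H^c) (i : {linear M -> X}),
    [/\ A X,
        inflation E i,
        forall (j : int) (N : lmodType H^c), S j N -> Ext1_eq0 E N X &
        forall h : int,
          (exists x : Fil ht (h - 1) M, x != 0) ->
          (forall h' : int, (exists x : Fil ht (h' - 1) M, x != 0) -> h <= h') ->
          bijective (@Fil_map K H ht (h - 1) M X i)].
Proof.
have [exA _ _] := subAE.
have exE := sub_short_exact subAE.
have [b bP] := height_bounded htP ssHK.
have tfM : torsion_free (resK M) by case: subAE => _ /(_ _ AM)[].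
pose nz (h : int) := exists x : Fil ht (h - 1) M, x != 0.
(* h0 is the minimal h with M^{h-1} nonzero if there is one. Otherwise the second condition is
   vacuous and h0 = 1 works, heights being positive. *)
have [h0 [h0_low h0_min]] : exists h0 : int,
    (forall a, a < h0 -> forall x, filt ht (a - 1) M x -> x = 0) /\
    forall h, nz h -> (forall h', nz h' -> h <= h') -> h <= h0.
  have [[h [nz_h h_min]]|no_min] :=
    pselect (exists h, nz h /\ forall h', nz h' -> h <= h').
    exists h; split=> [a ah x x_low|h' _ h'_min]; last exact: h'_min.
    apply/eqP; case: eqP => // /eqP x0; suff /h_min : nz a by lia.
    by exists (Subm (introT (submod_predP _ _) x_low)); rewrite -val_eqE.
  exists 1; split=> [a a0 x|h nz_h h_min].
    by apply: (filt_nonpos htP tfM); lia.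
  by case: no_min; exists h.
have splM a N : a < h0 -> S a N -> splits E N M.
  by move=> /h0_low M0 SN; exact (splits_low htP SP subAE E_filt SN M0).
(* With n = |b + 1 - h0| strata, h0 + n exceeds b even when h0 itself already does. *)
have [X [i [adm_i splX]]] := split_strata noethK finH htP SP subAE E_filt
  (absz (b + 1 - h0)%R) finS AM splM.
exists X, i; have [inf_i _ bij_i] := adm_i; have AX := admissible_A subAE adm_i.
split=> // [j N SN|h nz_h h_min]; last first.
  (* Admissibility at h0 fixes the levels below h0, and h - 1 < h0. *)
  by apply: bij_i; have := h0_min h nz_h h_min; lia.
apply: (Ext1_eq0_section exA exE (A_S j N SN) AX).
(* Above the bound b the objects of S_j are zero. *)
have [jb|bj] := leP j b; last exact (splits_gt_bound SP bP bj SN).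
by apply: (splX j) => //; lia.
Qed.
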